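(* Let $N\ge1$ and let $\Sigma_N:\mathrm{int}\,M_N^{[0,1]}\to\mathbb{B}_{N,2}$ be the composition of (i) the canonical moments map $(m_1,\dots,m_N)\mapsto(c_1,\dots,c_N)$ from $\mathrm{int}\,M_N^{[0,1]}$ onto $(0,1)^N$, (ii) the coordinatewise map $t\mapsto2t-1$ from $(0,1)^N$ onto $(-1,1)^N$, and (iii) the inverse canonical coordinate map $\mathcal{C}_N^{-1}$ from $(-1,1)^N$ onto $\mathbb{B}_{N,2}$. Then the pushforward by $\Sigma_N$ of the uniform probability measure on $M_N^{[0,1]}$ is the $2$-Generalized Dirichlet distribution on $\mathbb{B}_{N,2}$ with parameters $a_1=a_2=\dots=a_N=1/2$ and $b_j=N-j+1$, $j=1,2,\dots,N$.
   Context: Moment space: $M_N^{[0,1]}=\{(\int_0^1t^j\mu(dt))_{1\le j\le N}:\mu\text{ a probability measure on }[0,1]\}\subset\mathbb{R}^N$; the uniform probability measure is normalized Lebesgue measure. Canonical moments: for $(m_1,\dots,m_N)\in\mathrm{int}\,M_N^{[0,1]}$, $c_1=m_1$ and, for $1\le n<N$, $c_{n+1}=\frac{m_{n+1}-c_{n+1}^-}{c_{n+1}^+-c_{n+1}^-}$, where $c_{n+1}^+$ and $c_{n+1}^-$ are the maximum and the minimum of $\{r\in\mathbb{R}:(m_1,\dots,m_n,r)\in M_{n+1}^{[0,1]}\}$. This is a bijection from $\mathrm{int}\,M_N^{[0,1]}$ onto $(0,1)^N$. Ball: $\mathbb{B}_{N,2}=\{x\in\mathbb{R}^N:\sum_ix_i^2<1\}$.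 The canonical coordinate map $\mathcal{C}_N:\mathbb{B}_{N,2}\to(-1,1)^N$ sends $x$ to $(c_1,\dots,c_N)$ with $c_k=x_k/\sqrt{1-x_1^2-\dots-x_{k-1}^2}$; it is a bijection with inverse $[\mathcal{C}_N^{-1}(c)]_k=c_k\sqrt{(1-c_1^2)\cdots(1-c_{k-1}^2)}$. Generalized Dirichlet distributions: $\mathcal{S}_N^<=\{(x_1,\dots,x_N):x_i>0\ \forall i,\ \sum_i x_i<1\}$, and $\mathcal{GD}_{\mathbf a,\mathbf b}$ is the probability distribution on $\mathcal{S}_N^<$ with Lebesgue density $$\frac1{\mathcal{Z}(\mathbf a,\mathbf b)}\,p_{N+1}^{b_N-1}\prod_{j=1}^N\Big[p_j^{a_j-1}(1-p_1-\dots-p_{j-1})^{b_{j-1}-(a_j+b_j)}\Big],\qquad p_{N+1}=1-p_1-\dots-p_N,$$ with $\mathcal{Z}(\mathbf a,\mathbf b)=\prod_{j=1}^N\Gamma(a_j)\Gamma(b_j)/\Gamma(a_j+b_j)$ (for $j=1$ the base of the last power is $1$, so $b_0$ plays no role). The $2$-Generalized Dirichlet distribution on $\mathbb{B}_{N,2}$ with parameter $(\mathbf a,\mathbf b)$ is the law of $(\varepsilon_1\rho_1^{1/2},\dots,\varepsilon_N\rho_N^{1/2})$, where $(\rho_1,\dots,\rho_N)$ has distribution $\mathcal{GD}_{\mathbf a,\mathbf b}$ and the $\varepsilon_i$ are independent Rademacher variables ($\pm1$ with probability $1/2$), independent of $(\rho_1,\dots,\rho_N)$. *)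

(* Defs.v *)
From HB Require Import structures.
From mathcomp Require Import all_boot all_order all_algebra.
From mathcomp Require Import all_classical all_reals all_analysis.
Set Implicit Arguments.
Unset Strict Implicit.
Unset Printing Implicit Defensive.
Import Order.TTheory GRing.Theory Num.Theory.
Import numFieldNormedType.Exports.
Local Open Scope classical_set_scope.
Local Open Scope ring_scope.

(* Throughout, R^n is n.-tuple R, which carries the product sigma-algebra, and
   coordinates are numbered from 0: the k-th coordinate (k >= 1) of an
   informal vector x is tnth x i with val i = k.-1. *)

Section cons_measure.
Context d (T : measurableType d) (R : realType).
Variables (mu : {sigma_finite_measure set T -> \bar R}) (n : nat)
  (nu : {sigma_finite_measure set (n.-tuple T) -> \bar R}).

Let consp (p : T * n.-tuple T) : n.+1.-tuple T := [tuple of p.1 :: p.2].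
Let unconsp (x : n.+1.-tuple T) : T * n.-tuple T :=
  (thead x, [tuple of behead x]).

Let measurable_consp : measurable_fun setT consp.
Proof. exact: measurable_cons. Qed.

Let measurable_unconsp : measurable_fun setT unconsp.
Proof.
apply: measurable_fun_pair; last exact: measurable_behead.
exact: measurable_tnth.
Qed.

Let conspK : cancel consp unconsp.
Proof. by case=> a b; congr pair; apply: val_inj. Qed.

Definition cons_measure : set (n.+1.-tuple T) -> \bar R :=
  pushforward (mu \x nu)%E consp.

Let cons_measure0 : cons_measure set0 = 0%E.
Proof. by rewrite /cons_measure /pushforward preimage_set0 measure0. Qed.

Let cons_measure_ge0 A : (0 <= cons_measure A)%E.
Proof. exact: measure_ge0. Qed.

Let cons_measure_sigma_additive : semi_sigma_additive cons_measure.
Proof. exact: (@measure_semi_sigma_additive _ _ _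
  (measure_function_pushforward__canonical__measure_function_Measure
     (mu \x nu)%E measurable_consp)). Qed.

HB.instance Definition _ := isMeasure.Build _ _ _ cons_measure
  cons_measure0 cons_measure_ge0 cons_measure_sigma_additive.

Let cons_measure_sigma_finite : sigma_finite setT cons_measure.
Proof.
have /sigma_finiteP[F [TF ndF Foo]] := sigma_finiteT mu.
have /sigma_finiteP[G [TG ndG Goo]] := sigma_finiteT nu.
exists (fun k => unconsp @^-1` (F k `*` G k)).
  apply/seteqP; split=> // x _.
  have [i _ Fi] : (\bigcup_i F i) (unconsp x).1 by rewrite -TF.
  have [j _ Gj] : (\bigcup_i G i) (unconsp x).2 by rewrite -TG.
  exists (maxn i j) => //; split => /=.
    by move: Fi; exact/subsetPset/ndF/leq_maxl.
  by move: Gj; exact/subsetPset/ndG/leq_maxr.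
move=> k; have [mF Fy] := Foo k; have [mG Gy] := Goo k; split.
  rewrite -[X in measurable X]setTI; apply: measurable_unconsp => //.
  exact: measurableX.
rewrite /cons_measure /pushforward -comp_preimage.
rewrite (_ : unconsp \o consp = id); last exact/funext.
by rewrite preimage_id product_measure1E// lte_mul_pinfty// ge0_fin_numE.
Qed.

HB.instance Definition _ := Measure_isSigmaFinite.Build _ _ _ cons_measure
  cons_measure_sigma_finite.

End cons_measure.

Section power_measure.
Context d (T : measurableType d) (R : realType).
Variable mu : {sigma_finite_measure set T -> \bar R}.

(* The n-fold product measure mu^n on T^n. *)
Fixpoint power_measure n : {sigma_finite_measure set (n.-tuple T) -> \bar R} :=
  match n with
  | 0 => \d_[tuple]
  | m.+1 => cons_measure mu (power_measure m)
  end.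

(* It has the expected value on boxes; by sigma-finiteness, this determines
   it. *)
Lemma power_measure_box n (A : 'I_n -> set T) :
  (forall i, measurable (A i)) ->
  power_measure n [set x | forall i, A i (tnth x i)] =
  (\prod_(i < n) mu (A i))%E.
Proof.
elim: n A => [|n IHn] A mA /=.
  rewrite big_ord0 diracE mem_set//=; by case.
rewrite big_ord_recl -(IHn (fun i => A (lift ord0 i)))// /cons_measure.
rewrite /pushforward -product_measure1E//; last first.
  rewrite (_ : [set _ | _] =
    \bigcap_(i in [set: 'I_n]) ((@tnth _ T)^~ i @^-1` A (lift ord0 i))).
    apply: fin_bigcap_measurable => // i _.
    by rewrite -[X in measurable X]setTI; exact: measurable_tnth.
  by apply/seteqP; split=> x /= Ax i; [move=> _; exact: Ax|exact: (Ax i)].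
congr product_measure1; apply/seteqP; split=> -[a b] /=.
  move=> Aab; split; first exact: (Aab ord0).
  by move=> i; have := Aab (lift ord0 i); rewrite tnthS.
move=> [Aa Ab] i; case: (unliftP ord0 i) => [j ->|-> //].
by rewrite tnthS; exact: Ab.
Qed.

End power_measure.

Section moment_space.
Context {R : realType}.

Definition lebesgue_Rn (n : nat) :
    {sigma_finite_measure set (n.-tuple (measurableTypeR R)) -> \bar R} :=
  power_measure (@lebesgue_measure R) n.

(* Interior for the usual topology of R^n, which the library puts on row
   vectors and not on tuples. *)
Definition interior_Rn n (A : set (n.-tuple R)) : set (n.-tuple R) :=
  [set x | ([set v : 'rV[R]_n | A [tuple v 0 i | i < n]])°
             (\row_i tnth x i)].

Definition moment_space n : set (n.-tuple R) :=
  [set m | exists mu : probability (measurableTypeR R) R,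
    mu `[0, 1]%classic = 1%E /\
    forall j : 'I_n,
      (tnth m j)%:E = (\int[mu]_(t in `[0%R, 1%R]) (t ^+ j.+1)%:E)%E].

(* The maximum (minimum) of S when it exists; otherwise an arbitrary value. *)
Definition set_max (S : set R) : R := get (S `&` ubound S).
Definition set_min (S : set R) : R := get (S `&` lbound S).

(* The r such that (m_1, ..., m_k, r) is in the moment space of order k + 1. *)
Definition moment_range N (m : N.-tuple R) (k : nat) : set R :=
  [set r | @moment_space k.+1
     [tuple if (i < k)%N then nth 0 m i else r | i < k.+1]].

Definition canonical_moments N (m : N.-tuple R) : N.-tuple R :=
  [tuple if val k == 0%N then tnth m k
         else (tnth m k - set_min (moment_range m k)) /
              (set_max (moment_range m k) - set_min (moment_range m k))
  | k < N].

Definition ball2 N : set (N.-tuple R) :=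
  [set x | \sum_(i < N) tnth x i ^+ 2 < 1].

Definition canonical_coords N (x : N.-tuple R) : N.-tuple R :=
  [tuple tnth x k / Num.sqrt (1 - \sum_(i < N | (i < k)%N) tnth x i ^+ 2)
  | k < N].

Definition canonical_coords_inv N (c : N.-tuple R) : N.-tuple R :=
  [tuple tnth c k * Num.sqrt (\prod_(i < N | (i < k)%N) (1 - tnth c i ^+ 2))
  | k < N].

Let prod_coords N (u c : 'I_N -> R) :
  (forall k : 'I_N, \prod_(i < N | (i < k)%N) (1 - c i ^+ 2) =
             1 - \sum_(i < N | (i < k)%N) u i ^+ 2 ->
     u k ^+ 2 = c k ^+ 2 * (1 - \sum_(i < N | (i < k)%N) u i ^+ 2)) ->
  forall k : nat, (k <= N)%N -> \prod_(i < N | (i < k)%N) (1 - c i ^+ 2) =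
    1 - \sum_(i < N | (i < k)%N) u i ^+ 2.
Proof.
move=> uc; elim=> [_|k IHk kN]; first by rewrite !big_pred0// subr0.
have {}IHk := IHk (ltnW kN); have uck := uc (Ordinal kN) IHk.
have ltE (i : 'I_N) :
    (i < k.+1)%N && (i != Ordinal kN) = (i < k)%N.
  by rewrite -(inj_eq val_inj)/= ltnS andbC -ltn_neqAle.
rewrite (bigD1 (Ordinal kN))//= [X in _ = 1 - X](bigD1 (Ordinal kN))//=.
rewrite (eq_bigl _ _ ltE) [X in _ = 1 - (_ + X)](eq_bigl _ _ ltE).
by rewrite uck IHk mulrBl mul1r opprD addrA addrAC.
Qed.

(* canonical_coords_inv is inverse to canonical_coords. *)
Lemma canonical_coords_invK N (c : N.-tuple R) :
  (forall i, `|tnth c i| < 1) -> canonical_coords (canonical_coords_inv c) = c.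
Proof.
move=> c1.
have P_gt0 (k : 'I_N) : 0 < \prod_(i < N | (i < k)%N) (1 - tnth c i ^+ 2).
  apply: prodr_gt0 => i _; rewrite subr_gt0 -real_normK ?num_real//.
  by rewrite expr_lt1.
apply: eq_from_tnth => k; rewrite tnth_mktuple.
rewrite -(@prod_coords N (tnth (canonical_coords_inv c)) (tnth c))//.
- by rewrite tnth_mktuple mulfK// gt_eqF// sqrtr_gt0.
- move=> j <-; rewrite tnth_mktuple exprMn sqr_sqrtr//; exact/ltW/P_gt0.
- exact: ltnW.
Qed.

Lemma canonical_coordsK N (x : N.-tuple R) :
  ball2 x -> canonical_coords_inv (canonical_coords x) = x.
Proof.
rewrite /ball2 /= => x1.
have S_gt0 (k : nat) : 0 < 1 - \sum_(i < N | (i < k)%N) tnth x i ^+ 2.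
  rewrite subr_gt0; apply: le_lt_trans x1.
  rewrite [leRHS](bigID (fun i : 'I_N => (i < k)%N))/= lerDl.
  by apply: sumr_ge0 => i _; exact: sqr_ge0.
apply: eq_from_tnth => k; rewrite tnth_mktuple.
rewrite (@prod_coords N (tnth x) (tnth (canonical_coords x)))//.
- by rewrite tnth_mktuple divfK// gt_eqF// sqrtr_gt0.
- move=> j _; rewrite tnth_mktuple expr_div_n sqr_sqrtr ?divfK//.
  + by rewrite gt_eqF.
  + exact: ltW.
- exact: ltnW.
Qed.

Definition Sigma_map N (m : N.-tuple R) : N.-tuple R :=
  canonical_coords_inv
    [tuple 2 * tnth (canonical_moments m) k - 1 | k < N].

Definition uniform_moment_space N (A : set (N.-tuple R)) : \bar R :=
  (lebesgue_Rn N (A `&` @moment_space N) *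
     ((fine (lebesgue_Rn N (@moment_space N)))^-1)%:E)%E.

(* Image of P by a map f which is only meaningful on the set D. *)
Definition pushforward_on T1 T2 (P : set T1 -> \bar R) (D : set T1)
    (f : T1 -> T2) (A : set T2) : \bar R := P (D `&` f @^-1` A).

End moment_space.

Section generalized_dirichlet.
Context {R : realType}.

Definition Gamma_fun (a : R) : R :=
  (\int[lebesgue_measure]_(t in `]0%R, +oo[) (t `^ (a - 1) * expR (- t)))%R.

Definition open_simplex N : set (N.-tuple R) :=
  [set p | (forall i, 0 < tnth p i) /\ \sum_(i < N) tnth p i < 1].

(* The parameters a_1, ..., a_N and b_1, ..., b_N are a 1, ..., a N and
   b 1, ..., b N; the values a 0 and b 0 are irrelevant, as b 0 only occurs in
   the exponent of a power of 1. *)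
Definition GD_const N (a b : nat -> R) : R :=
  \prod_(1 <= j < N.+1)
     (Gamma_fun (a j) * Gamma_fun (b j) / Gamma_fun (a j + b j)).

Definition GD_density N (a b : nat -> R) (p : N.-tuple R) : R :=
  (GD_const N a b)^-1 *
  (1 - \sum_(i < N) tnth p i) `^ (b N - 1) *
  \prod_(j < N)
    (tnth p j `^ (a j.+1 - 1) *
     (1 - \sum_(i < N | (i < j)%N) tnth p i) `^ (b j - (a j.+1 + b j.+1))).

Definition GD N (a b : nat -> R) (A : set (N.-tuple R)) : \bar R :=
  (\int[lebesgue_Rn N]_(p in A `&` @open_simplex N) (GD_density a b p)%:E)%E.

(* A Rademacher variable is (-1) ^+ e for a fair coin e : bool; independence
   is expressed by the product measure. *)
Definition two_GD N (a b : nat -> R) : set (N.-tuple R) -> \bar R :=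
  pushforward
    (@GD N a b \x power_measure (bernoulli_prob (2^-1 : R)) N)%E
    (fun w : N.-tuple R * N.-tuple bool =>
       [tuple (-1) ^+ tnth w.2 i * Num.sqrt (tnth w.1 i) | i < N]).

End generalized_dirichlet.

(* Main.v *)
(** The moments of a measure with canonical moments c_1, c_2, ... are weighted
    counts of Dyck paths, a descent from height n being weighted by
    (1 - c_(n-1)) c_n.  Hence m_(k+1) is affine in c_(k+1), with slope
    prod_(i <= k) c_i (1 - c_i).  Integrating the squares of the orthogonal
    polynomials of the weights (and, multiplied by 1 - x^2, of those of the dual
    weights c_n (1 - c_(n+1))) shows that the moments of a measure satisfy
    0 <= c_(k+1) <= 1; conversely the spectral theorem for the Jacobi matrix
    provides an atomic measure for every c in [0, 1]^N.  So c_(k+1) is the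
    canonical moment, and the uniform measure on the moment space has density
    proportional to prod_i (c_i (1 - c_i))^(N - i) in these coordinates.

    Stick breaking turns the generalized Dirichlet distribution into a product
    of Beta(1/2, N - j + 1) distributions as well, and this is the law of
    (2c - 1)^2 when c has density proportional to (c (1 - c))^(N - j).  The
    constants agree because both measures are probabilities; that the Beta
    integrals are quotients of Gamma values follows from Tonelli's theorem. *)

Require Import Defs.
From HB Require Import structures.
From mathcomp Require Import all_boot all_order all_algebra.
From mathcomp Require complex.
From mathcomp Require Import ring lra zify.
From mathcomp Require Import all_classical all_reals all_analysis.
From mathcomp Require Import measurable_realfun unstable.
Set Implicit Arguments.
Unset Strict Implicit.
Unset Printing Implicit Defensive.
Import Order.TTheory GRing.Theory Num.Theory.
Import numFieldNormedType.Exports.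
Local Open Scope classical_set_scope.
Local Open Scope ring_scope.

(** * Weighted paths and orthogonal polynomials *)

(** The paths encode an even functional: a measure on [0, 1] is pulled back under t = x ^ 2 with a
    fair sign. Thus the recurrence of the orthogonal polynomials has no diagonal term, and 1 - x ^ 2
    is the nonnegative factor behind the upper bound for c_(k+1). The endpoints 0 and 1 are allowed
    in the quadrature because canonical moments are defined through an attained maximum and minimum.
    Both changes of variables are triangular: each coordinate is affine in its own variable, with
    coefficients depending on the earlier ones, so Tonelli and affine substitution on the line
    replace a general Jacobian theorem. Their inverses may degenerate once a coordinate equals 0 or
    1, but such points form a null set. This also settles the boundary: the moment space and its
    interior are only located between the preimage of the open cube and that preimage enlarged by
    the null set. *)

Section path_sums.
Context {R : comNzRingType}.
Implicit Types (z : nat -> R) (p : {poly R}).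

Fixpoint path_sum z (j n : nat) : R :=
  if j is j'.+1 then path_sum z j' n.+1 + z n * path_sum z j' n.-1
  else (n == 0)%:R.

Lemma path_sum_lt z j n : (j < n)%N -> path_sum z j n = 0.
Proof.
elim: j n => [|j IHj] [|n]//= jn.
by rewrite !IHj ?mulr0 ?addr0//; lia.
Qed.

Lemma path_sum_diag z n : path_sum z n n = \prod_(1 <= i < n.+1) z i.
Proof.
elim: n => [|n IHn]; first by rewrite big_geq.
by rewrite /= path_sum_lt// add0r IHn mulrC [RHS]big_nat_recr.
Qed.

Lemma path_sum_odd z j n : z 0 = 0 -> odd (j + n) -> path_sum z j n = 0.
Proof.
move=> z0; elim: j n => [|j IHj] [|n]//= jn.
  by rewrite z0 mul0r addr0 IHj//; lia.
by rewrite !IHj ?mulr0 ?addr0//; lia.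
Qed.

(** A path of length [j] from [n] down to 0 never exceeds the height [(j + n) / 2]. *)
Lemma eq_path_sum z z' j n : z 0 = 0 -> z' 0 = 0 ->
  (forall i, (i.*2 <= j + n)%N -> z i = z' i) ->
  path_sum z j n = path_sum z' j n.
Proof.
move=> z0 z0'; elim: j n => [//|j IHj] [|n] zz' /=.
  by rewrite z0 z0' !mul0r !addr0; apply: IHj => i ij; apply: zz'; lia.
congr (_ + _); first by apply: IHj => i ij; apply: zz'; lia.
have [jn|nj] := ltnP j n; first by rewrite !path_sum_lt// !mulr0.
rewrite (IHj n); first by rewrite zz'//; lia.
by move=> i ij; apply: zz'; lia.
Qed.

(* Among the paths of length j from height n, only the one that climbs first
   reaches the height k.+1. *)
Lemma path_sumB z z' k j n : z 0 = 0 -> z' 0 = 0 ->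
  (forall i, (i <= k)%N -> z i = z' i) -> (n <= j)%N -> (j + n = k.+1.*2)%N ->
  path_sum z j n - path_sum z' j n =
  (z k.+1 - z' k.+1) * \prod_(1 <= i < k.+1) z i.
Proof.
move=> z0 z0' zz'; elim: j n => [|j IHj] n nj jnk.
  by move: nj jnk; rewrite leqn0 => /eqP->.
have wz : \prod_(1 <= i < k.+1) z' i = \prod_(1 <= i < k.+1) z i.
  by rewrite big_nat [RHS]big_nat; apply: eq_bigr => i /andP[_ ik]; rewrite zz'.
have [nk|kn] := leqP n k.
  rewrite /= (zz' n nk); have -> : path_sum z j n.-1 = path_sum z' j n.-1.
    by apply: eq_path_sum => // i ijn; apply: zz'; lia.
  by rewrite opprD addrACA subrr addr0 IHj//; lia.
have [-> ->] : j = k /\ n = k.+1 by lia.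
 rewrite /= !(@path_sum_lt _ k k.+2)// !add0r !path_sum_diag wz.
by rewrite mulrBl.
Qed.

(** For [n = 0] this is the moment functional; for general [n] it turns out to be the moment
    functional of [p * orthopoly z n]. *)
Definition path_functional z n p : R := \sum_(i < size p) p`_i * path_sum z i n.

Lemma path_functional_widen z n p m : (size p <= m)%N ->
  path_functional z n p = \sum_(i < m) p`_i * path_sum z i n.
Proof.
move=> pm; rewrite /path_functional (big_ord_widen _ (fun i => p`_i * path_sum z i n) pm).
rewrite [RHS](bigID (fun i : 'I_m => (i < size p)%N))/=.
rewrite [X in _ = _ + X]big1 ?addr0// => i; rewrite -leqNgt => ip.
by rewrite nth_default ?mul0r.
Qed.

Lemma path_functionalD z n : {morph path_functional z n : p q / p + q}.
Proof.
move=> p q; pose m := maxn (size p) (size q).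
rewrite !(@path_functional_widen _ _ _ m) ?leq_maxl ?leq_maxr ?size_polyD//.
by rewrite -big_split; apply: eq_bigr => i _; rewrite coefD mulrDl.
Qed.

Lemma path_functionalZ z n a p : path_functional z n (a *: p) = a * path_functional z n p.
Proof.
rewrite (@path_functional_widen _ _ _ (size p)) ?size_scale_leq// big_distrr/=.
by apply: eq_bigr => i _; rewrite coefZ mulrA.
Qed.

Lemma path_functionalB z n : {morph path_functional z n : p q / p - q}.
Proof. by move=> p q; rewrite path_functionalD -scaleN1r path_functionalZ mulN1r. Qed.

Lemma path_functionalMX z n p : path_functional z n (p * 'X) =
  path_functional z n.+1 p + z n * path_functional z n.-1 p.
Proof.
rewrite (@path_functional_widen _ _ _ (size p).+1); last first.
  by rewrite (leq_trans (size_polyMleq _ _))// size_polyX addn2.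
rewrite big_ord_recl coefMX mul0r add0r /path_functional big_distrr -big_split/=.
by apply: eq_bigr => i _; rewrite coefMX/=; ring.
Qed.

(* The monic orthogonal polynomials of the functional [path_functional z 0]. *)
Fixpoint orthopoly z n : {poly R} :=
  if n is n1.+1 then
    if n1 is n2.+1 then orthopoly z n1 * 'X - z n1 *: orthopoly z n2 else 'X
  else 1.

(** Multiplying by ['X] adds a first step to the paths, which is the three-term recurrence seen from
    the other side. Orthogonality is then geometric: a path from height [n] cannot reach 0 in fewer
    than [n] steps. Two consecutive indices are carried because the recurrence has order two. *)
Lemma path_functional_orthopoly z n p : z 0 = 0 ->
  path_functional z 0 (p * orthopoly z n) = path_functional z n p.
Proof.
move=> z0; suff : path_functional z 0 (p * orthopoly z n) = path_functional z n p /\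
    path_functional z 0 (p * orthopoly z n.+1) = path_functional z n.+1 p by case.
elim: n p => [|n IHn] p.
  by rewrite mulr1; split=> //; rewrite path_functionalMX z0 mul0r addr0.
split; first by have [] := IHn p.
have -> : p * orthopoly z n.+2 =
    p * 'X * orthopoly z n.+1 - z n.+1 *: (p * orthopoly z n).
  rewrite [orthopoly z n.+2]/= -/(orthopoly z n.+1) -!mul_polyC. ring.
rewrite path_functionalB path_functionalZ.
have [_ ->] := IHn (p * 'X); have [-> _] := IHn p.
by rewrite path_functionalMX addrK.
Qed.

Lemma orthopoly_monic z n :
  orthopoly z n \is monic /\ size (orthopoly z n) = n.+1.
Proof.
suff : (orthopoly z n \is monic /\ size (orthopoly z n) = n.+1) /\
    (orthopoly z n.+1 \is monic /\ size (orthopoly z n.+1) = n.+2) by case.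
elim: n => [|n [[mn sn] [mn1 sn1]]].
  by rewrite /= monic1 monicX size_poly1 size_polyX.
split=> //; rewrite [orthopoly z n.+2]/= -/(orthopoly z n.+1).
have lts : (size (- (z n.+1 *: orthopoly z n))
    < size (orthopoly z n.+1 * 'X)%R)%N.
  rewrite size_polyN size_monicM ?monicX -?size_poly_eq0 ?size_polyX ?sn1//.
  by rewrite (leq_ltn_trans (size_scale_leq _ _))// sn addn2.
split; last by rewrite size_polyDl// size_monicM ?monicX -?size_poly_eq0 ?size_polyX ?sn1// addn2.
by rewrite monicE lead_coefDl// -monicE monicMl ?monicX.
Qed.

Lemma path_functional_lt z n p : (size p <= n)%N -> path_functional z n p = 0.
Proof.
move=> pn; rewrite /path_functional big1// => i _; rewrite path_sum_lt ?mulr0//.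
exact: leq_trans pn.
Qed.

Lemma path_functional_monic z n p : p \is monic -> size p = n.+1 ->
  path_functional z n p = \prod_(1 <= i < n.+1) z i.
Proof.
move=> pm pn; rewrite (@path_functional_widen _ _ _ n.+1) ?pn// big_ord_recr/=.
rewrite big1 ?add0r; last by move=> i _; rewrite path_sum_lt ?mulr0.
have -> : p`_n = 1 by move: pm; rewrite monicE lead_coefE pn => /eqP.
by rewrite mul1r path_sum_diag.
Qed.

Lemma path_functional_orthopoly_sqr z n : z 0 = 0 ->
  path_functional z 0 (orthopoly z n ^+ 2) = \prod_(1 <= i < n.+1) z i.
Proof.
move=> z0; have [pm pn] := orthopoly_monic z n.
by rewrite expr2 path_functional_orthopoly// path_functional_monic.
Qed.

End path_sums.

(** * Chain sequences and their duals *)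

Section chain.
Context {R : comNzRingType}.
Implicit Types (c : nat -> R).

(** A chain sequence in the sense of Wall, with parameter sequence [c]. *)
Definition chain c n : R := (1 - c n.-1) * c n.

(* The orthogonal polynomials of the dual chain are orthogonal with respect to
   the functional p |-> path_functional ((1 - 'X^2) * p). *)
Definition dual_chain c n : R := c n * (1 - c n.+1).

(** Christoffel's formula for the factor [x ^ 2 - 1]. The coefficient makes the right-hand side
    vanish at 1 and -1, since the polynomial of degree [k + 1] of the chain takes the value
    [prod_(1 <= i <= k) (1 - c i)] at 1. *)
Lemma dual_orthopoly c k : c 0 = 0 ->
  ('X^2 - 1) * orthopoly (dual_chain c) k =
  orthopoly (chain c) k.+2 - ((1 - c k) * (1 - c k.+1)) *: orthopoly (chain c) k.
Proof.
move=> c0; pose Q := orthopoly (dual_chain c); pose P := orthopoly (chain c).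
pose e k := ('X^2 - 1) * Q k = P k.+2 - ((1 - c k) * (1 - c k.+1)) *: P k.
suff : e k /\ e k.+1 by case.
have PE n : P n.+2 = P n.+1 * 'X - ((1 - c n) * c n.+1)%:P * P n.
  by rewrite mul_polyC.
have QE n : Q n.+2 = Q n.+1 * 'X - (c n.+1 * (1 - c n.+2))%:P * Q n.
  by rewrite mul_polyC.
have P0 : P 0 = 1 by []; have P1 : P 1 = 'X by [].
have Q0 : Q 0 = 1 by []; have Q1 : Q 1 = 'X by [].
elim: k => [|k [ek ek1]].
  split; rewrite /e -!mul_polyC !PE P1 P0 ?Q1 ?Q0 c0 !polyCM !polyCB polyC0 polyC1.
    by ring.
  by ring.
split=> //; rewrite /e QE mulrBr mulrA ek1 mulrCA ek.
rewrite -!mul_polyC (PE k.+2) (PE k.+1) (PE k) !polyCM !polyCB polyC1.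
ring.
Qed.

(** The factor [1 - c i] of each weight is paired with the [c i] of the preceding one; only the last
    [c] stays alone. *)
Lemma prod_chain c n : c 0 = 0 ->
  \prod_(1 <= i < n.+2) chain c i =
  (\prod_(1 <= i < n.+1) (c i * (1 - c i))) * c n.+1.
Proof.
move=> c0; elim: n => [|n IHn].
  by rewrite big_nat1 /chain/= big_geq// c0 subr0.
rewrite big_nat_recr//= IHn [in RHS]big_nat_recr//= /chain/=; ring.
Qed.

(** By [dual_orthopoly] one factor [Q], of degree [k], meets [orthopoly (chain c) k], where only its
    leading coefficient counts, and [orthopoly (chain c) k.+2], to which it is orthogonal. *)
Lemma path_functional_dual c k : c 0 = 0 ->
  path_functional (chain c) 0 ((1 - 'X^2) * orthopoly (dual_chain c) k ^+ 2) =
  (\prod_(1 <= i < k.+1) (c i * (1 - c i))) * (1 - c k.+1).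
Proof.
move=> c0; have z0 : chain c 0 = 0 by rewrite /chain c0 mulr0.
have [Qm Qk] := orthopoly_monic (dual_chain c) k.
set Q := orthopoly _ _.
have -> : (1 - 'X^2) * Q ^+ 2 =
    ((1 - c k) * (1 - c k.+1)) *: (Q * orthopoly (chain c) k) -
    Q * orthopoly (chain c) k.+2.
  have := dual_orthopoly k c0; rewrite -/Q -!mul_polyC => /eqP.
  rewrite eq_sym subr_eq => /eqP ->; ring.
rewrite path_functionalB path_functionalZ !path_functional_orthopoly//.
rewrite (@path_functional_lt _ _ k.+2) ?Qk// subr0 path_functional_monic//.
case: k {Q Qm} Qk => [|k] Qk; first by rewrite !big_geq// c0; ring.
rewrite prod_chain// [in RHS]big_nat_recr//=; ring.
Qed.

End chain.

(** * Spectral measure of a real symmetric matrix *)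

Lemma diagonalizable_exp (F : fieldType) n (A P : 'M[F]_n.+1) (D : 'rV_n.+1) j :
  P \in unitmx -> A = invmx P *m diag_mx D *m P ->
  A ^+ j = invmx P *m diag_mx (\row_i (D 0 i ^+ j)) *m P.
Proof.
move=> uP AE; elim: j => [|j IHj].
  rewrite expr0 (_ : diag_mx _ = 1%:M) ?mulmx1 ?mulVmx//.
  by apply/matrixP => a b; rewrite !mxE expr0.
rewrite exprSr IHj {1}AE -[LHS]/(_ *m _) !mulmxA (mulmxK uP).
rewrite -(mulmxA _ (diag_mx _) (diag_mx _)) mulmx_diag.
by congr (_ *m diag_mx _ *m _); apply/rowP => i; rewrite !mxE exprSr.
Qed.

Module Spectral.
Import complex.

Section symmetric_spectral.
Context {R : rcfType} (n : nat).
Variable S : 'M[R]_n.+1.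
Hypothesis Ssym : S^T = S.

Let RC : R -> R[i] := real_complex R.
Let A : 'M[R[i]]_n.+1 := map_mx RC S.
Let P := spectralmx A.
Let D := spectral_diag A.

Let A_herm : A \is hermitianmx n.+1 false Num.conj.
Proof.
apply: realsym_hermsym.
  by rewrite qualifE/= expr0 scale1r map_mx_id// map_trmx Ssym.
apply/mxOverP => i j; rewrite mxE; apply/complex_realP; by exists (S i j).
Qed.

Let A_eq : A = invmx P *m diag_mx D *m P.
Proof. exact/orthomx_spectralP/hermitian_normalmx/A_herm. Qed.

Let d i : R := complex.Re (D 0 i).

Let dE i : D 0 i = RC (d i).
Proof.
have /mxOverP/(_ 0 i) := hermitian_spectral_diag_real A_herm.
by move=> /RRe_real <-.
Qed.

Let w i : R := complex.Re (`|P i 0| ^+ 2).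

Let wE i : `|P i 0| ^+ 2 = RC (w i).
Proof. by rewrite -[LHS]RRe_real// realX// normr_real. Qed.

(** The diagonalisation takes place over [R[i]], and [w i] is the squared modulus of the first
    coordinate of the i-th eigenvector: the spectral measure at the first basis vector. The real
    eigenvectors of the last clause serve to bound the eigenvalues. *)
Lemma symmetric_spectral : exists d w : 'I_n.+1 -> R,
  [/\ forall i, 0 <= w i,
      forall j, (S ^+ j) 0 0 = \sum_i w i * d i ^+ j &
      forall i, exists2 v : 'I_n.+1 -> R, exists k, v k != 0 &
        forall k, d i * v k = \sum_l v l * S l k].
Proof.
exists d, w; split=> [i|j|i].
- by rewrite -ler0c -/(RC _) -wE exprn_ge0.
- apply: (@complexI R); rewrite -/RC.
  have -> : RC ((S ^+ j) 0 0) = (A ^+ j) 0 0 by rewrite -(rmorphXn (map_mx RC)) mxE.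
  rewrite (diagonalizable_exp j (spectral_unit A) A_eq).
  rewrite invmx_unitary ?spectral_unitarymx// [RHS]rmorph_sum mxE.
  apply: eq_bigr => i _; rewrite [RHS]rmorphM [in RHS]rmorphXn/= -/RC -wE -dE -/P.
  rewrite mul_mx_diag !mxE normCK; ring.
have dP k : RC (d i) * P i k = \sum_l P i l * RC (S l k).
  have : (P *m A) i k = (diag_mx D *m P) i k.
    by rewrite {1}A_eq -/P mulmxA (mulKVmx (spectral_unit A)).
  rewrite mul_diag_mx !mxE -dE => <-; apply: eq_bigr => l _; by rewrite mxE.
have [k Pk] : exists k, P i k != 0.
  apply/existsP; apply: contraT; rewrite negb_exists => /forallP P0.
  have := spectral_unit A; rewrite -/P -row_free_unit => /row_freeP[Q] PQ.
  have /matrixP/(_ i i) := PQ; rewrite !mxE eqxx big1 => [/eqP|l _].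
    by rewrite eq_sym oner_eq0.
  by have := P0 l; rewrite negbK => /eqP ->; rewrite mul0r.
have ReM (x : R) (y : R[i]) : complex.Re (y * RC x) = complex.Re y * x.
  by case: y => a b /=; ring.
have ImM (x : R) (y : R[i]) : complex.Im (y * RC x) = complex.Im y * x.
  by case: y => a b /=; ring.
have ReS (F : 'I_n.+1 -> R[i]) :
    complex.Re (\sum_l F l) = \sum_l complex.Re (F l).
  by apply: (big_morph (@complex.Re R)) => // -[a b] [c e].
have ImS (F : 'I_n.+1 -> R[i]) :
    complex.Im (\sum_l F l) = \sum_l complex.Im (F l).
  by apply: (big_morph (@complex.Im R)) => // -[a b] [c e].
(* [S] and the eigenvalue are real, so the real and imaginary parts of the eigenvector both satisfy
   the equation, and one of them is nonzero at [k]. *)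
have [Re0|Re0] := eqVneq (complex.Re (P i k)) 0.
- exists (fun k => complex.Im (P i k)).
    exists k; apply: contraNneq Pk => Im0; by rewrite [P i k]complexE Re0 Im0 mulr0 addr0.
  by move=> l; rewrite mulrC -ImM mulrC dP ImS; apply: eq_bigr => m _; rewrite ImM.
- exists (fun k => complex.Re (P i k)); first by exists k.
  by move=> l; rewrite mulrC -ReM mulrC dP ReS; apply: eq_bigr => m _; rewrite ReM.
Qed.

End symmetric_spectral.
End Spectral.

(** * Quadrature for a finite chain *)

Section jacobi.
Context {R : rcfType} (c : nat -> R) (N : nat).
Hypotheses (c0 : c 0 = 0) (c01 : forall i, 0 <= c i <= 1)
  (cN : forall i, (N < i)%N -> c i = 0).

Let z := chain c.
Let s n := Num.sqrt (z n).

Let z_ge0 n : 0 <= z n.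
Proof.
by rewrite mulr_ge0//; [have /andP[] := c01 n.-1; rewrite subr_ge0|have /andP[] := c01 n].
Qed.

Let zN n : (N < n)%N -> z n = 0.
Proof. by move=> Nn; rewrite /z /chain (cN Nn) mulr0. Qed.

(** Transfer matrix of the paths, symmetrised by sharing each weight equally between the rise and
    the descent. The finite size loses nothing, as [z] vanishes above [N]. *)
Definition jacobi : 'M[R]_N.+1 := \matrix_(a, b)
  (if b == a.+1 :> nat then s b else if a == b.+1 :> nat then s a else 0).

Lemma jacobi_sym : jacobi^T = jacobi.
Proof.
apply/matrixP => a b; rewrite !mxE.
by case: ifPn => [/eqP ->|_]; first by rewrite ifN_eqC//; lia.
Qed.

(** At both ends the missing neighbour is multiplied by [s 0] or [s N.+1], which are 0. *)
Lemma jacobi_sum (v : nat -> R) (a : 'I_N.+1) :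
  \sum_(b < N.+1) jacobi a b * v b = s a.+1 * v a.+1 + s a * v a.-1.
Proof.
have [z0 zN1] : s 0 = 0 /\ s N.+1 = 0.
  by rewrite /s (zN (ltnSn N)) /z /chain c0 mulr0 sqrtr0.
transitivity (\sum_(b < N.+1) (if b == a.+1 :> nat then s a.+1 * v a.+1 else 0) +
    \sum_(b < N.+1) (if a == b.+1 :> nat then s a * v a.-1 else 0)).
  rewrite -big_split; apply: eq_bigr => b _; rewrite mxE/=.
  case: ifPn => [/eqP ->|_]; first by rewrite ifN ?addr0//; lia.
  by case: ifPn => [/eqP ->|_]; rewrite ?mul0r ?add0r.
congr (_ + _); rewrite -big_mkcond/=.
  have [aN|Na] := ltnP a N.
    by rewrite (big_pred1 (Ordinal (aN : a.+1 < N.+1)%N)).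
  have -> : a = N :> nat by have := ltn_ord a; lia.
  rewrite zN1 mul0r big_pred0// => b; have := ltn_ord b; lia.
case: a => -[|a] /= aN.
  by rewrite z0 mul0r big_pred0.
by rewrite (big_pred1 (Ordinal (ltnW aN : a < N.+1)%N))// => b; rewrite -val_eqE/= eqSS eq_sym.
Qed.

Let om n := \prod_(1 <= i < n.+1) s i.

(** Symmetrising amounts to conjugation by the diagonal of the [om n]. Canonical moments 0 and 1
    make some [om n] vanish, so the identity multiplies by [om n] instead of dividing. *)
Lemma path_sum_jacobi j (n : 'I_N.+1) :
  path_sum z j n = om n * (jacobi ^+ j) n 0.
Proof.
pose M j n := (jacobi ^+ j) (inord n) 0.
have -> : (jacobi ^+ j) n 0 = M j n by rewrite /M inord_val.
have omS k : om k.+1 = om k * s k.+1 by rewrite /om big_nat_recr.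
have zE k : z k = s k ^+ 2 by rewrite sqr_sqrtr.
have z0 : s 0 = 0 by rewrite /s /z /chain c0 mulr0 sqrtr0.
(* Heights above [N] are included because the recursion leaves the range at [k = N]; no path of
   nonzero weight returns from there. *)
suff H k : path_sum z j k = om k * (if (k <= N)%N then M j k else 0).
  by rewrite H -ltnS ltn_ord.
elim: j k => [|j IHj] k /=.
  rewrite /M expr0; case: k => [|k].
    by rewrite leq0n mxE -val_eqE/= inordK// /om big_geq// mul1r.
  by case: ifPn => [kN|]; rewrite ?mulr0// mxE -val_eqE/= inordK// mulr0.
rewrite !IHj; have [kN|kN] := leqP k N; last first.
  have kN1 : (k.+1 <= N)%N = false by lia.
  by rewrite kN1 (zN (n:=k)) ?mulr0 ?mul0r ?addr0.
have -> : M j.+1 k = s k.+1 * M j k.+1 + s k * M j k.-1.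
  have := jacobi_sum (M j) (inord k); rewrite inordK// => <-.
  rewrite /M exprS mxE; apply: eq_bigr => b _; by rewrite inord_val.
rewrite mulrDr; congr (_ + _).
  case: ifPn => kN1; first by rewrite omS mulrA.
  have -> : k = N by lia.
  by rewrite /s (zN (ltnSn N)) sqrtr0 mul0r !mulr0.
case: k kN => [|k] kN; first by rewrite zE z0 expr0n/= !mul0r mulr0.
by rewrite zE omS /= ifT; [ring|lia].
Qed.

(** [sc] splits each edge term between its two ends, [s n.+1] being the geometric mean of [1 - c n]
    and [c n.+1]. The vertex [n] receives [c n] from below and at most [1 - c n] from above, so the
    quadratic form of the matrix is bounded by the squared norm. *)
Lemma jacobi_eigen_le1 (d : R) (v : nat -> R) (k : 'I_N.+1) : v k != 0 ->
  (forall n : 'I_N.+1, d * v n = s n.+1 * v n.+1 + s n * v n.-1) -> d ^+ 2 <= 1.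
Proof.
move=> vk dv; pose a n := `|v n|.
have sc n : 2 * (s n.+1 * a n.+1 * a n) <= (1 - c n) * a n ^+ 2 + c n.+1 * a n.+1 ^+ 2.
  have /andP[c0n c1n] := c01 n; have /andP[c0n1 c1n1] := c01 n.+1.
  have -> : s n.+1 = Num.sqrt (1 - c n) * Num.sqrt (c n.+1).
    by rewrite -sqrtrM ?subr_ge0.
  have p1 : Num.sqrt (1 - c n) ^+ 2 = 1 - c n by rewrite sqr_sqrtr ?subr_ge0.
  have p2 : Num.sqrt (c n.+1) ^+ 2 = c n.+1 by rewrite sqr_sqrtr.
  rewrite -[1 - c n in leRHS]p1 -[c n.+1 in leRHS]p2.
  rewrite -subr_ge0; set u := (X in 0 <= X).
  suff -> : u = (Num.sqrt (1 - c n) * a n - Num.sqrt (c n.+1) * a n.+1) ^+ 2.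
    exact: sqr_ge0.
  by rewrite /u; ring.
pose g n := `|d| * a n ^+ 2.
pose q n := if n is m.+1 then (1 - c m) * a m ^+ 2 else 0.
have gle (n : 'I_N.+1) : 2 * g n <= a n ^+ 2 + q n + c n.+1 * a n.+1 ^+ 2.
  have : `|d| * a n <= s n.+1 * a n.+1 + s n * a n.-1.
    rewrite /a -normrM dv (le_trans (ler_normD _ _))//.
    by rewrite !normrM !(ger0_norm (sqrtr_ge0 _)).
  have a0 : 0 <= a n by exact: normr_ge0.
  move=> /(ler_wpM2r a0); rewrite mulrDl => le1.
  have := sc n; rewrite /g /q.
  case: n a0 le1 => -[|n] /= nN a0 le1.
    move: le1; rewrite {2}/s /z /chain c0 mulr0 sqrtr0; nra.
  have := sc n; nra.
have sumq m : \sum_(n < m.+1) (a n ^+ 2 + q n + c n.+1 * a n.+1 ^+ 2) =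
    2 * \sum_(n < m.+1) a n ^+ 2 - (1 - c m) * a m ^+ 2 + c m.+1 * a m.+1 ^+ 2.
  elim: m => [|m IHm]; first by rewrite !big_ord_recl !big_ord0/= c0; ring.
  rewrite big_ord_recr IHm [in RHS]big_ord_recr/=; ring.
have : 2 * \sum_(n < N.+1) g n <= 2 * \sum_(n < N.+1) a n ^+ 2.
  rewrite big_distrr/=; apply: le_trans (ler_sum _ (fun n _ => gle n)) _.
  rewrite sumq (cN (ltnSn N)) mul0r addr0 gerBl mulr_ge0 ?sqr_ge0// subr_ge0.
  by have /andP[] := c01 N.
rewrite ler_pM2l// -big_distrr/= ger_pMl; last first.
  rewrite lt_def sumr_ge0 ?andbT => [|i _]; last exact: sqr_ge0.
  rewrite psumr_neq0 => [|i _]; last exact: sqr_ge0.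
  apply/hasP; exists k; first by rewrite mem_index_enum.
  by rewrite lt_def sqr_ge0 andbT sqrf_eq0 /a normr_eq0.
by rewrite -real_normK ?num_real// expr_le1.
Qed.

(** Gauss quadrature for the even functional. Only even moments matter, so the nodes are squares of
    eigenvalues, and the bound on these puts the nodes in [0, 1]. *)
Lemma chain_quadrature : exists t w : 'I_N.+1 -> R,
  [/\ forall i, 0 <= w i, forall i, 0 <= t i <= 1 &
      forall j, path_sum z j.*2 0 = \sum_i w i * t i ^+ j].
Proof.
have [d [w [w0 dw dv]]] := Spectral.symmetric_spectral jacobi_sym.
exists (fun i => d i ^+ 2), w; split=> // [i|j].
- rewrite sqr_ge0/=; have [v [k vk] dvk] := dv i.
  apply: (@jacobi_eigen_le1 _ (fun n => v (inord n)) k).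
    by rewrite inord_val.
  move=> n; rewrite inord_val dvk -(jacobi_sum (fun n => v (inord n))).
  by apply: eq_bigr => b _; rewrite inord_val mulrC -[in LHS]jacobi_sym mxE.
- rewrite -[0%N]/(val (ord0 : 'I_N.+1)) path_sum_jacobi /om big_geq// mul1r dw.
  by apply: eq_bigr => i _; rewrite -exprM mul2n.
Qed.

End jacobi.

(** * Iterated integrals and changes of variables *)

Section monotone.
Local Open Scope ereal_scope.
Context d (T : measurableType d) (R : realType).

Lemma ge0_le_integralT (mu : {measure set T -> \bar R}) (f g : T -> \bar R) :
  (forall x, 0 <= f x) -> (forall x, f x <= g x) ->
  \int[mu]_x f x <= \int[mu]_x g x.
Proof.
move=> f0 fg; have g0 x : 0 <= g x by rewrite (le_trans (f0 x)).
rewrite !ge0_integralTE//; apply: le_ereal_sup => _ [h hf <-].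
by exists h => // x; rewrite (le_trans (hf x)).
Qed.

(* Monotone on all sets, measurable or not: the integral of a nonnegative
   function is a supremum over the simple functions below it. This lets the
   moment space be squeezed between measurable sets of equal measure. *)
Lemma le_power_measure (mu : {sigma_finite_measure set T -> \bar R}) n
    (A B : set (n.-tuple T)) :
  A `<=` B -> power_measure mu n A <= power_measure mu n B.
Proof.
elim: n A B => [|n IHn] A B AB /=.
  rewrite !diracE lee_fin ler_nat; case: (boolP (_ \in A)) => // /set_mem.
  by move=> /AB /mem_set ->.
rewrite /cons_measure /pushforward /product_measure1.
apply: ge0_le_integralT => x; [exact: (measure_ge0 (power_measure mu n))|].
by apply: IHn => y; rewrite /xsection/= !inE; exact: AB.
Qed.

End monotone.

Section integral_cons.
Local Open Scope ereal_scope.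
Context d (T : measurableType d) (R : realType).

Lemma measurable_cons_pair n :
  measurable_fun setT (fun p : T * n.-tuple T => [tuple of p.1 :: p.2]).
Proof. exact: measurable_cons. Qed.

Lemma ge0_integral_power0 (mu : {sigma_finite_measure set T -> \bar R})
    (f : 0.-tuple T -> \bar R) : (forall x, 0 <= f x) ->
  \int[power_measure mu 0]_x f x = f [tuple].
Proof.
move=> f0; rewrite integral_dirac//= ?diracT ?mul1e//.
move=> _ Y mY; have [Yf|Yf] := pselect (Y (f [tuple])).
  rewrite (_ : _ `&` _ = setT)//; apply/seteqP; split=> // x _; split=> //=.
  by rewrite tuple0.
rewrite (_ : _ `&` _ = set0)//; apply/seteqP; split=> // x [_]/=.
by rewrite tuple0.
Qed.

Lemma ge0_integral_powerS (mu : {sigma_finite_measure set T -> \bar R}) n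
    (f : n.+1.-tuple T -> \bar R) :
  measurable_fun [set: n.+1.-tuple T] f -> (forall x, 0 <= f x) ->
  \int[power_measure mu n.+1]_x f x =
  \int[mu]_x \int[power_measure mu n]_y f [tuple of x :: y].
Proof.
move=> mf f0 /=.
rewrite (ge0_integral_pushforward (@measurable_cons_pair n))//.
rewrite preimage_setT fubini_tonelli1//; last by move=> x; exact: f0.
by apply: measurableT_comp => //; exact: measurable_cons_pair.
Qed.

Lemma measurable_integral_powerS (mu : {sigma_finite_measure set T -> \bar R}) n
    (f : n.+1.-tuple T -> \bar R) :
  measurable_fun [set: n.+1.-tuple T] f -> (forall x, 0 <= f x) ->
  measurable_fun setT (fun x => \int[power_measure mu n]_y f [tuple of x :: y]).
Proof.
move=> mf f0.
apply: (@measurable_fun_fubini_tonelli_F _ _ _ _ _ (power_measure mu n)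
  (fun p => f [tuple of p.1 :: p.2])) => //.
by apply: measurableT_comp => //; exact: measurable_cons_pair.
Qed.

End integral_cons.

(** * Densities and substitution on the line *)

Section density.
Local Open Scope ereal_scope.
Context d (T : measurableType d) (R : realType).
Variables (mu : {measure set T -> \bar R}) (g : T -> R).
Hypotheses (mg : measurable_fun setT g) (g0 : forall x, (0 <= g x)%R).

Definition density_measure (A : set T) := \int[mu]_(x in A) (g x)%:E.

Let density0 : density_measure set0 = 0.
Proof. exact: integral_set0. Qed.

Let density_ge0 A : 0 <= density_measure A.
Proof. by apply: integral_ge0 => x _; rewrite lee_fin. Qed.

Let density_sigma_additive : semi_sigma_additive density_measure.
Proof.
apply: semi_sigma_additive_nng_induced; first exact/measurable_EFinP.
by move=> x; rewrite lee_fin.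
Qed.

Definition density : {measure set T -> \bar R} :=
  HB.pack density_measure (isMeasure.Build _ _ _ density_measure
    density0 density_ge0 density_sigma_additive).

Import HBNNSimple.

Lemma ge0_integral_density (f : T -> \bar R) : measurable_fun setT f ->
  (forall x, 0 <= f x) ->
  \int[density_measure]_x f x = \int[mu]_x (f x * (g x)%:E).
Proof.
move=> mf f0; rewrite -[density_measure]/(density : set T -> \bar R).
pose h := nnsfun_approx measurableT mf.
have hf x : EFin \o h ^~ x @ \oo --> f x by exact: cvg_nnsfun_approx.
have hnd x : {homo (h ^~ x) : m n / (m <= n)%N >-> (m <= n)%R}.
  by move=> m n mn; exact/lefP/nd_nnsfun_approx.
have mh n : measurable_fun setT (EFin \o h n).
  by apply/measurable_EFinP; exact/measurable_funP.
have mEg : measurable_fun setT (EFin \o g) by exact/measurable_EFinP.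
have -> : \int[density]_x f x = limn (fun n => \int[density]_x (h n x)%:E).
  rewrite -monotone_convergence//; last 2 first.
  - by move=> n x _; rewrite lee_fin.
  - by move=> x _ m n mn; rewrite lee_fin; exact: hnd.
  by apply: eq_integral => x _; apply/esym/cvg_lim => //; exact: hf.
have -> : \int[mu]_x (f x * (g x)%:E) =
    limn (fun n => \int[mu]_x ((h n x)%:E * (g x)%:E)).
  rewrite -monotone_convergence//; last 3 first.
  - by move=> n; apply: emeasurable_funM; [exact: mh|exact: mEg].
  - by move=> n x _; rewrite mule_ge0// lee_fin.
  - by move=> x _ m n mn; rewrite lee_wpmul2r// lee_fin//; exact: hnd.
  apply: eq_integral => x _; apply/esym/cvg_lim => //.
  by apply: cvgeZr => //; exact: hf.
congr (limn _); apply/funext => n.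
have mi r : measurable_fun setT (fun x => (r * \1_(h n @^-1` [set r]) x)%:E).
  by apply/measurable_EFinP; exact: measurable_funM.
under eq_integral do rewrite fimfunE -fsumEFin//.
rewrite ge0_integral_fsum//; last first.
  by move=> m y _; rewrite EFinM; exact: nnfun_muleindic_ge0.
under [RHS]eq_integral => x _.
  rewrite fimfunE -fsumEFin// ge0_mule_fsuml; last first.
    by move=> y; rewrite EFinM; exact: nnfun_muleindic_ge0.
  over.
rewrite ge0_integral_fsum//; last 2 first.
- by move=> y; exact: emeasurable_funM.
- by move=> y x _; rewrite mule_ge0 ?lee_fin// -lee_fin EFinM; exact: nnfun_muleindic_ge0.
apply: eq_fsbigr => r /[!inE] -[t _ <-].
under eq_integral do rewrite EFinM.
under [RHS]eq_integral do rewrite EFinM -muleA.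
rewrite integralZl_indic_nnsfun// ge0_integralZl//; last 3 first.
- by apply: emeasurable_funM => //; exact/measurable_EFinP.
- by move=> x _; rewrite mule_ge0// lee_fin.
- by rewrite lee_fin.
congr (_ * _); rewrite integral_indic// setIT.
rewrite /= /density_measure integral_mkcond; apply: eq_integral => x _.
by rewrite epatch_indic muleC.
Qed.

End density.

Section affine.
Local Open Scope ereal_scope.
Context {R : realType}.
Local Notation mu := (@lebesgue_measure R).

Let measurable_affine (a b : R) :
  measurable_fun setT (fun c : measurableTypeR R => (a * c + b)%R : measurableTypeR R).
Proof. by apply: measurable_funD => //; exact: measurable_funM. Qed.

Lemma lebesgue_measure_affine (a b : R) A : (0 < a)%R -> measurable A ->
  a%:E * mu ((fun c => a * c + b)%R @^-1` A) = mu A.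
Proof.
move=> a0 mA.
pose nu := mscale (NngNum (ltW a0))
  (measure_function_pushforward__canonical__measure_function_Measure
    mu (measurable_affine a b)).
suff H X : ocitv X -> mu X = nu X.
  by rewrite [RHS](lebesgue_measure_unique H).
move=> [[u v] _ <-]/=.
rewrite /nu /mscale /= /pushforward.
rewrite (_ : (fun c => _) @^-1` _ = `]((u - b) / a)%R, ((v - b) / a)%R]%classic); last first.
  apply/seteqP; split=> x /=; rewrite !in_itv/=.
    by rewrite ltr_pdivrMr// ler_pdivlMr// mulrC ltrBlDr lerBrDr.
  by rewrite ltr_pdivrMr// ler_pdivlMr// [(x * a)%R]mulrC ltrBlDr lerBrDr.
rewrite !lebesgue_measure_itv/= !lte_fin ltr_pM2r ?invr_gt0// ltrD2r.
case: ifPn => _; last by rewrite mule0.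
rewrite -!EFinD -EFinM; congr EFin; field; exact: lt0r_neq0.
Qed.

Lemma ge0_integral_affine (a b : R) (f : R -> \bar R) : a != 0%R ->
  measurable_fun [set: R] f -> (forall x, 0 <= f x) ->
  \int[mu]_x f x = `|a|%:E * \int[mu]_x f (a * x + b)%R.
Proof.
have pos (c : R) (g : R -> \bar R) : (0 < c)%R ->
    measurable_fun [set: R] g -> (forall x, 0 <= g x) ->
    \int[mu]_x g x = c%:E * \int[mu]_x g (c * x + b)%R.
  move=> c0 mg g0.
  have := @ge0_integral_mscale _ _ R
    (measure_function_pushforward__canonical__measure_function_Measure
      mu (measurable_affine c b)) setT measurableT (NngNum (ltW c0)) g mg
    (fun x _ => g0 x).
  rewrite (ge0_integral_pushforward (measurable_affine c b))// preimage_setT /= => <-.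
  by apply: eq_measure_integral => A mA _; exact/esym/lebesgue_measure_affine.
move=> a0 mf f0; have [agt0|ale0] := ltP 0%R a.
  by rewrite (pos a)// gtr0_norm.
have {ale0}a_lt0 : (a < 0)%R by rewrite lt_neqAle a0.
rewrite (pos (- a)%R)// ?oppr_gt0// ltr0_norm//; congr (_ * _).
have mfa : measurable_fun [set: R] (fun x => f (a * x + b)%R).
  by apply: measurableT_comp => //; exact: measurable_affine.
have mN : measurable_fun setT (-%R : measurableTypeR R -> measurableTypeR R).
  exact: oppr_measurable.
have := @ge0_integral_pushforward _ _ _ _ R
  (-%R : measurableTypeR R -> measurableTypeR R) mN mu setT _
  measurableT mfa (fun x _ => f0 _).
rewrite preimage_setT /=.
under [X in _ = X -> _]eq_integral do rewrite mulrN -mulNr.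
move=> <-; apply: eq_measure_integral => A mA _; exact: lebesgue_measureN.
Qed.

End affine.

Section square.
Local Open Scope ereal_scope.
Context {R : realType}.
Local Notation mu := (@lebesgue_measure R).

Let g (x : R) : R := if (0 < x)%R then (2 * x)%R else 0%R.

Let mg : measurable_fun setT (g : measurableTypeR R -> measurableTypeR R).
Proof.
by apply: measurable_fun_ifT => //; exact: measurable_fun_ltr.
Qed.

Let g0 x : (0 <= g x)%R.
Proof. by rewrite /g; case: ifPn => // x0; rewrite mulr_ge0// ltW. Qed.

Let gE : EFin \o g = (fun x => (2 * x)%:E) \_ `]0%R, +oo[.
Proof.
apply/funext => x; rewrite /g patchE /= mem_setE in_itv/= andbT.
by case: ifPn.
Qed.

Lemma integral_double (a b : R) : (a < b)%R ->
  \int[mu]_(x in `]a, b]) (2 * x)%:E = (b ^+ 2 - a ^+ 2)%:E.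
Proof.
move=> ab; rewrite integral_itv_obnd_cbnd; last first.
  by apply/measurable_EFinP; exact: measurable_funM.
rewrite (@continuous_FTC2 _ (fun x => 2 * x)%R (fun x => x ^+ 2)%R)//.
- by apply: continuous_subspaceT => x; apply: mulrl_continuous.
- split.
  + by move=> x _; exact: exprn_derivable.
  + by apply: cvg_at_right_filter; exact: exprn_continuous.
  + by apply: cvg_at_left_filter; exact: exprn_continuous.
- by move=> x _; rewrite derive1E exp_derive expr1 /GRing.scale/= mulr1 mulr_natl.
Qed.

Let msq : measurable_fun setT
  (fun x : measurableTypeR R => (x ^+ 2)%R : measurableTypeR R).
Proof. exact: measurable_funX. Qed.

Let density_sqr (u v : R) : density_measure mu g ((fun x => x ^+ 2)%R @^-1` `]u, v]) =
  ((Num.max v 0 - Num.max u 0) *+ (u < v)%R)%:E.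
Proof.
rewrite /density_measure.
under eq_integral do rewrite -[(g _)%:E]/((EFin \o g) _) gE.
rewrite -integral_mkcondr.
(* [Num.sqrt] is 0 on negative numbers, so the same interval is correct when [u] or [v] is
   negative. *)
have -> : (fun x => x ^+ 2)%R @^-1` `]u, v] `&` `]0%R, +oo[ =
    `]Num.sqrt u, Num.sqrt v]%classic.
  apply/seteqP; split=> x /=; rewrite !in_itv/= andbT.
    move=> [/andP[ux xv] x0]; have x2 : x = Num.sqrt (x ^+ 2).
      by rewrite sqrtr_sqr gtr0_norm.
    by rewrite x2 ler_wsqrtr// andbT ltr_sqrt// exprn_gt0.
  move=> /andP[ux xv]; have x0 : (0 < x)%R by rewrite (le_lt_trans (sqrtr_ge0 _) ux).
  have v0 : (0 < v)%R by rewrite -sqrtr_gt0 (lt_le_trans x0).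
  split=> //; apply/andP; split.
    by rewrite -(@ltr_sqrt _ u) ?exprn_gt0// sqrtr_sqr gtr0_norm.
  by rewrite -(@ler_sqrt _ (x ^+ 2)%R v) ?(ltW v0)// sqrtr_sqr gtr0_norm.
have sqE (x : R) : (Num.sqrt x ^+ 2 = Num.max x 0)%R.
  have [x0|x0] := leP x 0%R; first by rewrite ler0_sqrtr// expr0n.
  by rewrite sqr_sqrtr// ltW.
have [ltuv|leuv] := ltP (Num.sqrt u) (Num.sqrt v).
  rewrite integral_double// !sqE ltNge; case: leP => // vu.
  by move: ltuv; rewrite ltNge ler_wsqrtr.
rewrite set_itv_ge ?bnd_simp -?leNgt// integral_set0.
have [uv|] := ltP u v => //; rewrite mulr1n.
have : (Num.sqrt v ^+ 2 <= Num.sqrt u ^+ 2)%R by rewrite ler_sqr ?nnegrE ?sqrtr_ge0.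
rewrite !sqE => le2; congr EFin; apply/eqP; rewrite eq_sym subr_eq0 eq_le le2/=.
by rewrite ge_max !le_max lexx (ltW uv) orbT.
Qed.

(* The two measures agree on intervals once the restriction of the Lebesgue
   measure to the negative half-line is added to the second one. *)
Lemma lebesgue_measure_sqr (A : set R) : measurable A -> A `<=` `]0%R, +oo[ ->
  mu A = density_measure mu g ((fun x => x ^+ 2)%R @^-1` A).
Proof.
move=> mA A0.
pose nu1 := measure_function_pushforward__canonical__measure_function_Measure
  (density mu mg g0) msq.
pose nu2 := mrestr mu (measurable_itv (R:=R) `]-oo, 0%R]).
pose nu := measure_add nu1 nu2.
have H X : ocitv X -> mu X = nu X.
  move=> [[u v] _ <-]/=; rewrite /nu measure_addE /nu1 /= /pushforward.
  rewrite density_sqr /nu2 /mrestr.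
  have -> : `]u, v]%classic `&` `]-oo, 0%R] = `]u, Num.min v 0%R]%classic.
    apply/seteqP; split=> x /=; rewrite !in_itv/= le_min.
      by move=> [/andP[-> ->] ->].
    by move=> /andP[-> /andP[-> ->]].
  rewrite !lebesgue_measure_itv/= !lte_fin.
  have [uv|vu] := ltP u v; last first.
    by rewrite ltNge ge_min vu/= adde0.
  rewrite mulr1n.
  have [v0|v0] := leP v 0%R; have [u0|u0] := leP u 0%R; rewrite ?uv ?lt_min ?uv//=.
  - by rewrite subrr add0e.
  - by have := lt_trans u0 uv; rewrite ltNge v0.
  - move: u0; rewrite le_eqVlt => /predU1P[->|u0].
      by rewrite ltxx ?adde0 -?EFinD; congr EFin; ring.
    by rewrite u0 -!EFinD; congr EFin; ring.
  - by rewrite ltNge (ltW u0)/= adde0.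
rewrite (lebesgue_measure_unique H mA) -[LHS]/(nu A) /nu measure_addE.
rewrite [X in _ + X](_ : _ = 0) ?adde0//.
rewrite -[LHS]/(mu (A `&` `]-oo, 0%R]%classic)) (_ : A `&` _ = set0)// -subset0 => x [/A0]/=.
by rewrite !in_itv/= andbT => x0; rewrite leNgt x0.
Qed.

Lemma ge0_integral_sqr (h : R -> \bar R) : measurable_fun [set: R] h ->
  (forall y, 0 <= h y) ->
  \int[mu]_(y in `]0%R, +oo[) h y =
  \int[mu]_(x in `]0%R, +oo[) (h (x ^+ 2)%R * (2 * x)%:E).
Proof.
move=> mh h0.
have mD : measurable (`]0%R, +oo[ : set (measurableTypeR R)) by [].
pose nu1 := measure_function_pushforward__canonical__measure_function_Measure
  (density mu mg g0) msq.
transitivity (\int[nu1]_(y in `]0%R, +oo[) h y).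
  by apply: eq_measure_integral => A mA AD; exact: lebesgue_measure_sqr.
rewrite [LHS](ge0_integral_pushforward msq)//; last exact: measurable_funTS.
rewrite integral_mkcond ge0_integral_density//; last 2 first.
- apply/(measurable_restrictT _ _).1.
    by rewrite -[X in measurable X]setTI; exact: msq.
  by apply: measurable_funTS; exact: measurableT_comp.
- by move=> x; apply: erestrict_ge0 => t _; exact: h0.
rewrite [RHS]integral_mkcond; apply: eq_integral => x _.
rewrite /g !patchE; have [x0|x0] := ltP 0%R x.
  by rewrite !mem_set//= in_itv/= andbT// exprn_gt0.
by rewrite mule0 [in RHS]memNset//= in_itv/= andbT ltNge x0.
Qed.

End square.

(** [powR] with exponent -1 gives the inverse on nonnegative bases; hence the detour through
    [f x ^+ 2]. Both sides are 0 where [f] vanishes. *)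
Lemma measurable_funV d (T : measurableType d) (R : realType) (f : T -> R) :
  measurable_fun setT f -> measurable_fun setT (fun x => (f x)^-1).
Proof.
move=> mf; rewrite (_ : (fun x => _) = (fun x => f x * (f x ^+ 2) `^ (-1))).
  apply: measurable_funM => //.
  exact: (measurableT_comp (measurable_powR (-1)) (measurable_funX 2 mf)).
apply/funext => x; rewrite powR_inv1 ?sqr_ge0//.
have [->|fx] := eqVneq (f x) 0; first by rewrite invr0 mul0r.
by field.
Qed.

(** The triangular maps recurse on lists with a growing prefix, so measurability is expressed entry
    by entry for list-valued maps of constant length. *)
Definition measurable_seq d (T : measurableType d) (R : realType) (n : nat)
    (s : T -> seq R) :=
  (forall z, size (s z) = n) /\
  forall i, measurable_fun setT (fun z => nth 0 (s z) i).

Section measurable_seq.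
Context d (T : measurableType d) (R : realType).
Implicit Types (s : T -> seq R) (f : T -> R).

Lemma measurable_seq_cst (p : seq R) : measurable_seq (size p) (fun _ : T => p).
Proof. by split. Qed.

Lemma measurable_seq_tuple n (g : T -> n.-tuple (measurableTypeR R)) :
  measurable_fun setT g <-> measurable_seq n (fun z => g z : seq R).
Proof.
split=> [/measurable_fun_tnthP mg|[_ mg]].
  split=> [z|i]; first by rewrite size_tuple.
  have [ni|ni] := leqP n i.
    rewrite (_ : (fun z => _) = cst 0)//; apply/funext => z.
    by rewrite nth_default ?size_tuple.
  have := mg (Ordinal ni); congr measurable_fun; apply/funext => z.
  by rewrite /= (tnth_nth 0).
apply/measurable_fun_tnthP => i.
have := mg i; congr measurable_fun; apply/funext => z.
by rewrite /= (tnth_nth 0).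
Qed.

Lemma measurable_seq_rcons n s f : measurable_seq n s -> measurable_fun setT f ->
  measurable_seq n.+1 (fun z => rcons (s z) (f z)).
Proof.
move=> [sn ms] mf; split=> [z|i]; first by rewrite size_rcons sn.
under eq_fun do rewrite nth_rcons sn.
by case: ltngtP => _; [exact: ms|exact: measurable_cst|exact: mf].
Qed.

Lemma measurable_seq_cons n s f : measurable_seq n s -> measurable_fun setT f ->
  measurable_seq n.+1 (fun z => f z :: s z).
Proof. by move=> [sn ms] mf; split=> [z|[|i]]//=; rewrite ?sn//; exact: ms. Qed.

Lemma measurable_seq_behead n s : measurable_seq n.+1 s ->
  measurable_seq n (fun z => behead (s z)).
Proof.
move=> [sn ms]; split=> [z|i]; first by rewrite size_behead sn.
by under eq_fun do rewrite nth_behead; exact: ms.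
Qed.

End measurable_seq.

(** * Triangular changes of variables *)

Section triangular.
Context {R : realType}.
Variables lo len : seq R -> R.

(* After a prefix p, the triangular map c |-> x and its inverse, where
   x_k = lo (p ++ (c_1 .. c_{k-1})) + len (p ++ (c_1 .. c_{k-1})) * c_k. *)
Fixpoint tri_fwd (p c : seq R) : seq R :=
  if c is a :: c' then (lo p + len p * a) :: tri_fwd (rcons p a) c' else [::].

Fixpoint tri_inv (p x : seq R) : seq R :=
  if x is b :: x' then
    (b - lo p) / len p :: tri_inv (rcons p ((b - lo p) / len p)) x'
  else [::].

(** The Jacobian matrix is triangular with the lengths on its diagonal, because [lo] and [len] see
    only earlier coordinates. *)
Fixpoint tri_jac (p c : seq R) : R :=
  if c is a :: c' then `|len p| * tri_jac (rcons p a) c' else 1.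

Lemma size_tri_fwd p c : size (tri_fwd p c) = size c.
Proof. by elim: c p => //= a c IHc p; rewrite IHc. Qed.

Lemma size_tri_inv p x : size (tri_inv p x) = size x.
Proof. by elim: x p => //= a x IHx p; rewrite IHx. Qed.

Lemma size_tri_fwd_tuple n p (c : n.-tuple R) : size (tri_fwd p c) == n.
Proof. by rewrite size_tri_fwd size_tuple. Qed.
Canonical tri_fwd_tuple n p (c : n.-tuple R) := Tuple (size_tri_fwd_tuple p c).

Lemma size_tri_inv_tuple n p (x : n.-tuple R) : size (tri_inv p x) == n.
Proof. by rewrite size_tri_inv size_tuple. Qed.
Canonical tri_inv_tuple n p (x : n.-tuple R) := Tuple (size_tri_inv_tuple p x).

Lemma tri_jac_ge0 p c : 0 <= tri_jac p c.
Proof. by elim: c p => //= a c IHc p; rewrite mulr_ge0. Qed.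

Lemma nth_tri_fwd p c k : (k < size c)%N -> nth 0 (tri_fwd p c) k =
  lo (p ++ take k c) + len (p ++ take k c) * nth 0 c k.
Proof.
elim: c p k => [//|a c IHc] p [|k] /=; first by rewrite cats0.
by rewrite ltnS => /IHc->; rewrite cat_rcons.
Qed.

Lemma tri_invK p x :
  (forall k, (k < size x)%N -> len (p ++ take k (tri_inv p x)) != 0) ->
  tri_fwd p (tri_inv p x) = x.
Proof.
elim: x p => //= b x IHx p lenp.
have lp : len p != 0 by have := lenp 0%N isT; rewrite cats0.
congr cons; first by rewrite mulrC divfK// addrC subrK.
by apply: IHx => k kx; have := lenp k.+1 kx; rewrite /= cat_rcons.
Qed.

Hypothesis mlo : forall d (T : measurableType d) k (s : T -> seq R),
  measurable_seq k s -> measurable_fun setT (fun z => lo (s z)).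
Hypothesis mlen : forall d (T : measurableType d) k (s : T -> seq R),
  measurable_seq k s -> measurable_fun setT (fun z => len (s z)).

Lemma measurable_tri_inv d (T : measurableType d) k n (s x : T -> seq R) :
  measurable_seq k s -> measurable_seq n x ->
  measurable_seq n (fun z => tri_inv (s z) (x z)).
Proof.
elim: n k s x => [|n IHn] k s x ms mx.
  have [x0 _] := mx; rewrite (_ : (fun z => _) = (fun z => [::])).
    exact: (measurable_seq_cst T [::]).
  by apply/funext => z; rewrite (size0nil (x0 z)).
pose c z := (nth 0 (x z) 0 - lo (s z)) / len (s z).
have mc : measurable_fun setT c.
  apply: measurable_funM; last exact/measurable_funV/(mlen ms).
  by apply: measurable_funB; [case: mx => _; exact|exact: (mlo ms)].
rewrite (_ : (fun z => _) =
    (fun z => c z :: tri_inv (rcons (s z) (c z)) (behead (x z)))).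
  apply: measurable_seq_cons => //.
  by apply: IHn (measurable_seq_rcons ms mc) (measurable_seq_behead mx).
by apply/funext => z; have [/(_ z)] := mx; rewrite /c; case: (x z).
Qed.

Lemma measurable_tri_fwd d (T : measurableType d) k n (s x : T -> seq R) :
  measurable_seq k s -> measurable_seq n x ->
  measurable_seq n (fun z => tri_fwd (s z) (x z)).
Proof.
elim: n k s x => [|n IHn] k s x ms mx.
  have [x0 _] := mx; rewrite (_ : (fun z => _) = (fun z => [::])).
    exact: (measurable_seq_cst T [::]).
  by apply/funext => z; rewrite (size0nil (x0 z)).
have mx0 : measurable_fun setT (fun z => nth 0 (x z) 0) by case: mx => _; exact.
pose c z := lo (s z) + len (s z) * nth 0 (x z) 0.
have mc : measurable_fun setT c.
  apply: measurable_funD; first exact: (mlo ms).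
  by apply: measurable_funM => //; exact: (mlen ms).
rewrite (_ : (fun z => _) =
    (fun z => c z :: tri_fwd (rcons (s z) (nth 0 (x z) 0)) (behead (x z)))).
  apply: measurable_seq_cons => //.
  by apply: IHn (measurable_seq_rcons ms mx0) (measurable_seq_behead mx).
by apply/funext => z; have [/(_ z)] := mx; rewrite /c; case: (x z).
Qed.

Lemma measurable_tri_jac d (T : measurableType d) k n (s x : T -> seq R) :
  measurable_seq k s -> measurable_seq n x ->
  measurable_fun setT (fun z => tri_jac (s z) (x z)).
Proof.
elim: n k s x => [|n IHn] k s x ms mx.
  have [x0 _] := mx; rewrite (_ : (fun z => _) = (fun z => 1))//.
  by apply/funext => z; rewrite (size0nil (x0 z)).
have mx0 : measurable_fun setT (fun z => nth 0 (x z) 0) by case: mx => _; exact.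
rewrite (_ : (fun z => _) = (fun z =>
    `|len (s z)| * tri_jac (rcons (s z) (nth 0 (x z) 0)) (behead (x z)))).
  apply: measurable_funM; last exact: IHn (measurable_seq_rcons ms mx0) (measurable_seq_behead mx).
  by apply: (measurableT_comp (@normr_measurable R setT)); exact: (mlen ms).
by apply/funext => z; have [/(_ z)] := mx; case: (x z).
Qed.

Hypothesis len_neq0 : forall p c, len p != 0 -> c != 0 -> c != 1 ->
  len (rcons p c) != 0.

Local Open Scope ereal_scope.

(** Tonelli isolates the first coordinate, where the map is affine; the induction hypothesis for the
    extended prefix handles the others. Composing [f] with the inverse makes the formula global:
    [tri_inv] is total and no image has to be described. *)
Lemma ge0_integral_tri n p (f : n.-tuple (measurableTypeR R) -> \bar R) :
  len p != 0%R -> measurable_fun [set: n.-tuple (measurableTypeR R)] f ->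
  (forall x, 0 <= f x) ->
  \int[lebesgue_Rn n]_x f [tuple of tri_inv p x] =
  \int[lebesgue_Rn n]_c (f c * (tri_jac p c)%:E).
Proof.
elim: n p f => [|n IHn] p f lenp mf f0.
  rewrite !ge0_integral_power0//=; last first.
    by move=> x; rewrite mule_ge0// lee_fin tri_jac_ge0.
  by rewrite mule1; congr f; apply: val_inj.
have mtnth0 : measurable_fun setT (fun t : n.+1.-tuple (measurableTypeR R) => nth 0%R t 0).
  by case: (measurable_seq_tuple (@id (n.+1.-tuple (measurableTypeR R)))) => + _;
    move=> /(_ (@measurable_id _ _ _))[].
have mid m : measurable_seq m (fun t : m.-tuple (measurableTypeR R) => t : seq R).
  by apply/(measurable_seq_tuple (@id (m.-tuple (measurableTypeR R)))); exact: measurable_id.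
rewrite /lebesgue_Rn !ge0_integral_powerS; last 4 first.
- apply: emeasurable_funM => //; apply/measurable_EFinP.
  exact: (measurable_tri_jac (measurable_seq_cst _ p) (mid _)).
- by move=> x; rewrite mule_ge0// lee_fin tri_jac_ge0.
- apply: measurableT_comp => //; apply/measurable_seq_tuple => /=.
  exact: (measurable_tri_inv (measurable_seq_cst _ p) (mid _)).
- by move=> x; exact: f0.
pose q (t : n.+1.-tuple (measurableTypeR R)) := rcons p (nth 0%R t 0).
pose hG (t : n.+1.-tuple (measurableTypeR R)) : n.+1.-tuple (measurableTypeR R) :=
  [tuple of nth 0%R t 0 :: tri_inv (q t) [tuple of behead t]].
have mq : measurable_seq (size p).+1 q.
  exact: measurable_seq_rcons (measurable_seq_cst _ p) mtnth0.
(* [G] and [H] are integrals over sections of functions of the whole tuple, so that Tonelli's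
   theorem gives their measurability. *)
pose G (c : R) := \int[power_measure (@lebesgue_measure R) n]_y
  f (hG [tuple of c :: y]).
have mG : measurable_fun [set: R] G.
  apply: (@measurable_integral_powerS _ _ R _ n (f \o hG)) => [|x]; last exact: f0.
  apply: measurableT_comp => //; apply/measurable_seq_tuple => /=.
  apply: measurable_seq_cons => //.
  apply: measurable_tri_inv; first exact: mq.
  exact: measurable_seq_behead (mid _).
have G0 c : 0 <= G c by apply: integral_ge0.
pose h (t : n.+1.-tuple (measurableTypeR R)) :=
  f t * (tri_jac (q t) (behead t))%:E.
have mh : measurable_fun [set: n.+1.-tuple (measurableTypeR R)] h.
  apply: emeasurable_funM => //; apply/measurable_EFinP.
  by apply: measurable_tri_jac; [exact: mq|exact: measurable_seq_behead (mid _)].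
have h0 t : 0 <= h t by rewrite mule_ge0// lee_fin tri_jac_ge0.
pose H (c : R) := \int[power_measure (@lebesgue_measure R) n]_y
  h [tuple of c :: y].
have mH : measurable_fun [set: R] H.
  exact: (@measurable_integral_powerS _ _ R _ n h).
have H0 c : 0 <= H c by apply: integral_ge0.
transitivity (\int[@lebesgue_measure R]_x G ((x - lo p) / len p)%R).
  apply: eq_integral => x _; apply: eq_integral => y _; congr f.
  exact: val_inj.
rewrite (ge0_integral_affine (lo p) lenp); last 2 first.
- apply: measurableT_comp => //.
  by apply: measurable_funM => //; exact: measurable_funB.
- by move=> x; exact: G0.
transitivity (`|len p|%:E * \int[@lebesgue_measure R]_x H x).
  congr (_ * _); apply: ge0_ae_eq_integral => //.
  - apply: measurableT_comp => //; apply: measurable_funM => //.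
    by apply: measurable_funB => //; apply: measurable_funD => //; exact: measurable_funM.
  (* For these two values of the coordinate the next length may vanish, and the induction hypothesis
     does not apply. *)
  - exists [set 0%R; 1%R]; split.
    + by apply: measurableU; exact: measurable_set1.
    + by rewrite measureU0//= ?lebesgue_measure_set1.
    + move=> x /= xGH; apply: contrapT => x01; apply: xGH => _.
      have -> : ((len p * x + lo p - lo p) / len p = x)%R.
        by rewrite addrK mulrC mulKf.
      rewrite /G /H -(IHn (rcons p x) (fun y => f [tuple of x :: y]))//.
      * apply: eq_integral => y _; congr f; exact: val_inj.
      * apply: len_neq0 => //; apply/eqP => x'; apply: x01; [left|right]; done.
      * by apply: measurableT_comp => //; exact: measurable_cons.
rewrite -ge0_integralZl//; apply: eq_integral => x _.
rewrite -ge0_integralZl//; last first.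
  by apply: measurableT_comp => //; exact: measurable_cons.
by apply: eq_integral => y _; rewrite /h/= muleCA -EFinM.
Qed.

End triangular.

(** * The unit cube and its faces *)

Section cube.
Context {R : realType}.

Definition open_cube n : set (n.-tuple R) :=
  [set c | forall i, 0 < tnth c i < 1].

(** Whole hyperplanes instead of the boundary of the cube, so that the other coordinates need not be
    controlled. *)
Definition cube_faces n : set (n.-tuple R) :=
  [set c | exists i, tnth c i = 0 \/ tnth c i = 1].

Lemma measurable_box n (A : 'I_n -> set (measurableTypeR R)) :
  (forall i, measurable (A i)) ->
  measurable ([set x | forall i, A i (tnth x i)] : set (n.-tuple (measurableTypeR R))).
Proof.
move=> mA; rewrite (_ : [set _ | _] =
    \bigcap_(i in [set: 'I_n]) ((@tnth _ _)^~ i @^-1` A i)).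
  apply: fin_bigcap_measurable => // i _.
  by rewrite -[X in measurable X]setTI; exact: measurable_tnth.
by apply/seteqP; split=> x /= Ax i; [move=> _; exact: Ax|exact: (Ax i)].
Qed.

Lemma measurable_open_cube n :
  measurable (@open_cube n : set (n.-tuple (measurableTypeR R))).
Proof.
have := @measurable_box n (fun=> `]0, 1[%classic) (fun=> measurable_itv _).
congr measurable; apply/seteqP; split=> x /= + i => /(_ i); rewrite ?in_itv//=.
Qed.

Let face n (i : 'I_n) (e : R) : set (n.-tuple (measurableTypeR R)) :=
  [set x | forall j, (if j == i then [set e] else setT) (tnth x j)].

Let faceE n (i : 'I_n) (e : R) x : face i e x <-> tnth x i = e.
Proof.
split=> [/(_ i)|xi j]; first by rewrite eqxx.
by case: eqVneq => // ->.
Qed.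

Let measurable_face n (i : 'I_n) e : measurable (face i e).
Proof.
apply: (@measurable_box n (fun j => if j == i then [set e] else setT)) => j.
by case: ifPn => _; [exact: measurable_set1|exact: measurableT].
Qed.

Let face0 n (i : 'I_n) e : lebesgue_Rn n (face i e) = 0%E.
Proof.
transitivity (\prod_(j < n) (@lebesgue_measure R) (if j == i then [set e] else setT))%E.
  apply: (@power_measure_box _ _ R (@lebesgue_measure R) n
    (fun j => if j == i then [set e] else setT)) => j.
  by case: ifPn => _; [exact: measurable_set1|exact: measurableT].
by rewrite (bigD1 i)//= eqxx lebesgue_measure_set1 mul0e.
Qed.

Let cube_facesE n : @cube_faces n =
  \bigcup_(i in [set: 'I_n]) (face i 0 `|` face i 1).
Proof.
apply/seteqP; split=> x /=.
  by move=> [i [xi|xi]]; exists i => //; [left|right]; exact/faceE.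
by move=> [i _ [/faceE xi|/faceE xi]]; exists i; [left|right].
Qed.

Lemma measurable_cube_faces n :
  measurable (@cube_faces n : set (n.-tuple (measurableTypeR R))).
Proof.
rewrite cube_facesE; apply: fin_bigcup_measurable => // i _.
by apply: measurableU; exact: measurable_face.
Qed.

Lemma lebesgue_Rn_cube_faces n : lebesgue_Rn n (@cube_faces n) = 0%E.
Proof.
pose F (k : nat) : set (n.-tuple (measurableTypeR R)) :=
  if insub k is Some i then face i 0 `|` face i 1 else set0.
have FE : @cube_faces n = \bigcup_k F k.
  rewrite cube_facesE; apply/seteqP; split=> x /=.
    by move=> [i _ fi]; exists i => //; rewrite /F valK.
  by move=> [k _]; rewrite /F; case: insubP => // i _ _ fi; exists i.
have mF k : measurable (F k).
  rewrite /F; case: insubP => [i _ _|_]; last exact: measurable0.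
  by apply: measurableU; exact: measurable_face.
have F0 k : lebesgue_Rn n (F k) = 0%E.
  rewrite /F; case: insubP => [i _ _|_]; last exact: measure0.
  by rewrite measureU0; [exact: face0|exact: measurable_face|exact: measurable_face|exact: face0].
apply/eqP; rewrite -measure_le0 FE.
apply: le_trans (generalized_Boole_inequality _ mF _) _.
  exact: bigcup_measurable.
by rewrite eseries0// => k _ _; exact: F0.
Qed.

Section tri_inv_cube.
Variables lo len : seq R -> R.
Hypothesis mlo : forall d (T : measurableType d) k (s : T -> seq R),
  measurable_seq k s -> measurable_fun setT (fun z => lo (s z)).
Hypothesis mlen : forall d (T : measurableType d) k (s : T -> seq R),
  measurable_seq k s -> measurable_fun setT (fun z => len (s z)).
Hypothesis len_neq0 : forall p c, len p != 0 -> c != 0 -> c != 1 ->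
  len (rcons p c) != 0.

Lemma measurable_tri_inv_tuple n p : measurable_fun setT
  (fun x : n.-tuple (measurableTypeR R) =>
     [tuple of tri_inv lo len p x] : n.-tuple (measurableTypeR R)).
Proof.
apply/measurable_seq_tuple => /=.
apply: (measurable_tri_inv mlo mlen (measurable_seq_cst _ p)).
by apply/(measurable_seq_tuple (@id (n.-tuple (measurableTypeR R)))); exact: measurable_id.
Qed.

Lemma measurable_tri_fwd_tuple n p : measurable_fun setT
  (fun x : n.-tuple (measurableTypeR R) =>
     [tuple of tri_fwd lo len p x] : n.-tuple (measurableTypeR R)).
Proof.
apply/measurable_seq_tuple => /=.
apply: (measurable_tri_fwd mlo mlen (measurable_seq_cst _ p)).
by apply/(measurable_seq_tuple (@id (n.-tuple (measurableTypeR R)))); exact: measurable_id.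
Qed.

Lemma measurable_tri_jac_tuple n p : measurable_fun setT
  (fun x : n.-tuple (measurableTypeR R) => tri_jac len p x).
Proof.
apply: (measurable_tri_jac mlen (measurable_seq_cst _ p)).
by apply/(measurable_seq_tuple (@id (n.-tuple (measurableTypeR R)))); exact: measurable_id.
Qed.

Lemma lebesgue_Rn_tri_inv n p (B : set (n.-tuple (measurableTypeR R))) :
  len p != 0 -> measurable B ->
  lebesgue_Rn n [set x : n.-tuple (measurableTypeR R) | B [tuple of tri_inv lo len p x]] =
  (\int[lebesgue_Rn n]_(c in B) (tri_jac len p c)%:E)%E.
Proof.
move=> lenp mB.
have mB' : measurable ([set x : n.-tuple (measurableTypeR R) |
    B [tuple of tri_inv lo len p x]] : set (n.-tuple (measurableTypeR R))).
  by rewrite -[X in measurable X]setTI; exact: measurable_tri_inv_tuple.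
have := integral_indic (lebesgue_Rn n) measurableT mB'; rewrite setIT => <-.
transitivity (\int[lebesgue_Rn n]_x (EFin \o \1_B) [tuple of tri_inv lo len p x])%E.
  by apply: eq_integral => x _.
rewrite (ge0_integral_tri mlo mlen len_neq0)//.
- rewrite [RHS]integral_mkcond; apply: eq_integral => c _.
  by rewrite epatch_indic/= muleC.
- by apply/measurable_EFinP; exact: measurable_indic.
- by move=> x /=; rewrite lee_fin.
Qed.

Lemma lebesgue_Rn_tri_inv_cube_faces n p : len p != 0 ->
  lebesgue_Rn n [set x : n.-tuple (measurableTypeR R) | @cube_faces n [tuple of tri_inv lo len p x]] = 0%E.
Proof.
move=> lenp; rewrite lebesgue_Rn_tri_inv//; last exact: measurable_cube_faces.
apply: null_set_integral.
- exact: measurable_cube_faces.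
- by apply/measurable_EFinP/measurable_funTS; exact: measurable_tri_jac_tuple.
- exact: lebesgue_Rn_cube_faces.
Qed.

End tri_inv_cube.

End cube.

(** * Canonical moments *)

Section moments_of_canonical.
Context {R : realType}.
Implicit Types (p s : seq R).

(* Canonical moments are numbered from 1, and the convention c_0 = 0 gives
   zeta_1 = c_1. *)
Definition canon_seq s (i : nat) : R := nth 0 (0 :: s) i.

Definition canon_moment s (k : nat) : R := path_sum (chain (canon_seq s)) k.*2 0.

(** [canon_seq] reads 0 beyond the end of [p], so this is the next moment when the next canonical
    moment is 0. *)
Definition moment_lo p : R := canon_moment p (size p).+1.

Definition moment_len p : R := \prod_(c <- p) (c * (1 - c)).

Lemma chain_canon0 s : chain (canon_seq s) 0 = 0.
Proof. by rewrite /chain /canon_seq/= mulr0. Qed.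

Lemma eq_canon_moment s s' k :
  (forall i, (i <= k)%N -> canon_seq s i = canon_seq s' i) ->
  canon_moment s k = canon_moment s' k.
Proof.
move=> ss'; apply: eq_path_sum; rewrite ?chain_canon0// => i ik.
by rewrite /chain !ss'//; lia.
Qed.

Lemma moment_lenE p :
  moment_len p = \prod_(1 <= i < (size p).+1) (canon_seq p i * (1 - canon_seq p i)).
Proof. by rewrite /moment_len (big_nth 0) big_add1. Qed.

(** The weights of [rcons p a] and of [p] agree up to index [size p], and the next weight of [p] is
    0, so the difference comes from the single highest path. Its top weight supplies the last factor
    [1 - c] that the product over the chain lacks. *)
Lemma canon_moment_rcons p a :
  canon_moment (rcons p a) (size p).+1 = moment_lo p + moment_len p * a.
Proof.
have cE i : (i <= size p)%N -> canon_seq (rcons p a) i = canon_seq p i.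
  by rewrite /canon_seq; case: i => // i; rewrite /= nth_rcons => ->.
have ca : canon_seq (rcons p a) (size p).+1 = a.
  by rewrite /canon_seq/= nth_rcons ltnn eqxx.
have cp : canon_seq p (size p).+1 = 0 by rewrite /canon_seq/= nth_default.
apply/eqP; rewrite addrC -subr_eq; apply/eqP.
rewrite /moment_lo /canon_moment (@path_sumB _ _ _ (size p)) ?chain_canon0//; last 2 first.
- by move=> i ip; rewrite /chain !cE//; lia.
- by rewrite addn0.
rewrite moment_lenE /chain/= ca cp mulr0 subr0.
case: (posnP (size p)) => [p0|].
  rewrite p0 !big_geq// mul1r mulr1.
  by rewrite /canon_seq/= subr0 mul1r.
case: (size p) cE => [//|n] cE _.
have -> : \prod_(1 <= i < n.+2) ((1 - canon_seq (rcons p a) i.-1) *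
    canon_seq (rcons p a) i) = \prod_(1 <= i < n.+2) chain (canon_seq p) i.
  by apply: eq_big_nat => i /andP[_ ip]; rewrite /chain !cE//; lia.
by rewrite prod_chain// [in RHS]big_nat_recr//= cE//; ring.
Qed.

Lemma moment_len_rcons p a : moment_len (rcons p a) = moment_len p * (a * (1 - a)).
Proof. by rewrite /moment_len -cats1 big_cat big_seq1. Qed.

Lemma moment_len_rcons_neq0 p c : moment_len p != 0 -> c != 0 -> c != 1 ->
  moment_len (rcons p c) != 0.
Proof.
move=> p0 c0 c1; rewrite moment_len_rcons !mulf_neq0//.
by rewrite subr_eq0 eq_sym.
Qed.

Lemma moment_len_gt0 p : (forall c, c \in p -> 0 < c < 1) -> 0 < moment_len p.
Proof.
move=> p01; rewrite /moment_len big_seq; apply: prodr_gt0 => c /p01/andP[c0 c1].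
by rewrite mulr_gt0// subr_gt0.
Qed.

Lemma nth_moment_fwd c k : (k < size c)%N ->
  nth 0 (tri_fwd moment_lo moment_len [::] c) k = canon_moment c k.+1.
Proof.
move=> kc; rewrite nth_tri_fwd//= -{1 2}(size_takel (ltnW kc)).
rewrite size_takel ?(ltnW kc)// -canon_moment_rcons size_takel ?(ltnW kc)//.
apply: eq_canon_moment => -[//|i]; rewrite /canon_seq/= => ik.
rewrite nth_rcons size_takel ?(ltnW kc)//.
move: ik; rewrite ltnS leq_eqVlt => /predU1P[->|ik]; first by rewrite ltnn eqxx.
by rewrite ik nth_take.
Qed.

End moments_of_canonical.

(** * Inequalities between the moments of a measure *)

Section moment_bounds.
Context {R : realType}.
Variable mu : probability (measurableTypeR R) R.

Let I01 : set (measurableTypeR R) := `[0, 1]%classic.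

Let mI01 : measurable I01. Proof. exact: measurable_itv. Qed.

Let mX n : measurable_fun setT (fun t : measurableTypeR R => t ^+ n).
Proof. exact: measurable_funX. Qed.

Let integrableX n : mu.-integrable I01 (fun t => (t ^+ n)%:E).
Proof.
apply: (@measurable_bounded_integrable _ _ R mu (fun t : R => t ^+ n) I01 mI01).
- by rewrite (@le_lt_trans _ _ 1%E) ?ltry// probability_le1.
- exact: measurable_funTS.
exists 1; split; first exact: num_real.
move=> y y1 t; rewrite /I01/= in_itv/= => /andP[t0 t1].
by rewrite ger0_norm ?exprn_ge0// (le_trans _ (ltW y1))// exprn_ile1.
Qed.

Let M n : R := fine (\int[mu]_(t in I01) (t ^+ n)%:E).

Let ME n : (\int[mu]_(t in I01) (t ^+ n)%:E = (M n)%:E)%E.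
Proof. by rewrite fineK//; exact: integrable_fin_num. Qed.

Let integral_poly (q : {poly R}) n : (size q <= n)%N ->
  (\int[mu]_(t in I01) (q.[t])%:E = (\sum_(i < n) q`_i * M i)%:E)%E.
Proof.
move=> qn; under eq_integral do rewrite (horner_coef_wide _ qn) -sumEFin.
rewrite integral_sum//.
  rewrite -sumEFin; apply: eq_bigr => i _.
  under eq_integral do rewrite EFinM.
  by rewrite integralZl// ME EFinM.
move=> i; apply: eq_integrable (integrableZl mI01 q`_i (integrableX i)) => //.
Qed.

Lemma even_poly_horner (p : {poly R}) x :
  (even_poly p).[x ^+ 2] = (p.[x] + p.[- x]) / 2.
Proof.
have E y : p.[y] = (even_poly p).[y ^+ 2] + (odd_poly p).[y ^+ 2] * y.
  by rewrite -[in LHS](poly_even_odd p) hornerD hornerM !horner_comp hornerX hornerXn.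
by rewrite !E sqrrN; field.
Qed.

(* path_functional z 0 is the mean over x = sqrt t or - sqrt t, with a fair sign. *)
Lemma path_functional_ge0 z n (p : {poly R}) : z 0 = 0 ->
  (forall j, (j <= n)%N -> path_sum z j.*2 0 = M j) ->
  (size p <= n.*2.+1)%N -> (forall x, -1 <= x <= 1 -> 0 <= p.[x]) ->
  0 <= path_functional z 0 p.
Proof.
move=> z0 zM pn p0.
have -> : path_functional z 0 p = \sum_(i < n.+1) (even_poly p)`_i * M i.
  rewrite (@path_functional_widen _ _ _ _ n.+1.*2); last by rewrite doubleS ltnW.
  transitivity (\sum_(i < n.+1) (even_poly p)`_i * path_sum z i.*2 0); last first.
    by apply: eq_bigr => i _; rewrite zM// -ltnS.
  elim: {zM pn} n.+1 => [|m IHm]; first by rewrite !big_ord0.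
  rewrite doubleS !big_ord_recr/= IHm coef_even_poly -addrA; congr (_ + _).
  rewrite -[path_sum z m.*2 1 + _]/(path_sum z m.*2.+1 0) (@path_sum_odd _ z m.*2.+1 0%N) ?mulr0 ?addr0//.
  lia.
rewrite -lee_fin -integral_poly; last first.
  by rewrite (leq_trans (size_even_poly _))//; lia.
apply: integral_ge0 => t; rewrite /I01/= in_itv/= => /andP[t0 t1].
rewrite lee_fin -(sqr_sqrtr t0) even_poly_horner.
have st : Num.sqrt t <= 1 by rewrite -sqrtr1 ler_sqrt.
have s0 := sqrtr_ge0 t.
have h1 : 0 <= p.[Num.sqrt t] by apply: p0; lra.
have h2 : 0 <= p.[- Num.sqrt t] by apply: p0; lra.
by rewrite divr_ge0// addr_ge0.
Qed.

(** The two test polynomials, the square for the chain and [1 - 'X^2] times the square for the dual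
    chain, both have degree [2 (k + 1)], so exactly the moments up to order [k + 1] enter. The
    factor [moment_len p] is divided out later, where it is known to be positive. *)
Lemma canon_moment_bounds p a :
  (forall j, (j <= (size p).+1)%N ->
     (\int[mu]_(t in `[0%R, 1%R]) (t ^+ j)%:E = (canon_moment (rcons p a) j)%:E)%E) ->
  0 <= moment_len p * a /\ 0 <= moment_len p * (1 - a).
Proof.
move=> pM; pose c := canon_seq (rcons p a); set k := size p in pM *.
have cM j : (j <= k.+1)%N -> path_sum (chain c) j.*2 0 = M j.
  by move=> jk; rewrite /M pM.
have c0 : c 0 = 0 by [].
have z0 : chain c 0 = 0 by exact: chain_canon0.
have lenE : moment_len p = \prod_(1 <= i < k.+1) (c i * (1 - c i)).
  rewrite moment_lenE; apply: eq_big_nat => i /andP[i0 ik].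
  by rewrite /c /canon_seq; case: i i0 ik => // i _; rewrite ltnS/= nth_rcons => ->.
have ca : c k.+1 = a by rewrite /c /canon_seq/= nth_rcons ltnn eqxx.
split.
  rewrite lenE -ca -prod_chain// -path_functional_orthopoly_sqr//.
  have [_ sP] := orthopoly_monic (chain c) k.+1.
  apply: (path_functional_ge0 z0 cM) => [|x _]; last by rewrite horner_exp sqr_ge0.
  by rewrite expr2 (leq_trans (size_polyMleq _ _))// sP; lia.
rewrite lenE -ca -path_functional_dual//.
have [_ sQ] := orthopoly_monic (dual_chain c) k.
apply: (path_functional_ge0 z0 cM) => [|x x1].
  rewrite (leq_trans (size_polyMleq _ _))//.
  have s1 : (size (1 - 'X^2 : {poly R})%R <= 3)%N.
    by rewrite (leq_trans (size_polyD _ _))// size_polyN size_poly1 size_polyXn.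
  have s2 : (size (orthopoly (dual_chain c) k ^+ 2)%R <= k.*2.+1)%N.
    by rewrite expr2 (leq_trans (size_polyMleq _ _))// sQ; lia.
  by rewrite -subn1 leq_subLR (leq_trans (leq_add s1 s2))//; lia.
rewrite hornerM horner_exp mulr_ge0 ?sqr_ge0// !hornerE; nra.
Qed.

End moment_bounds.

(** * Finitely supported probabilities *)

Section atomic_probability.
Context {R : realType} (n : nat) (t w : 'I_n.+1 -> R).
Hypotheses (w0 : forall i, 0 <= w i) (w1 : \sum_i w i = 1).

Let atom (k : nat) : {measure set (measurableTypeR R) -> \bar R} :=
  mscale (NngNum (w0 (inord k))) (\d_(t (inord k) : measurableTypeR R)).

Definition atomic_measure : set (measurableTypeR R) -> \bar R := msum atom n.+1.

HB.instance Definition _ := Measure.on atomic_measure.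

Let nu := atomic_measure.

Let ge0_integral_nu (D : set (measurableTypeR R)) (f : R -> R) :
  measurable D -> (forall i, D (t i)) -> measurable_fun [set: measurableTypeR R] f ->
  (forall x, D x -> 0 <= f x) ->
  (\int[nu]_(x in D) (f x)%:E = (\sum_i w i * f (t i))%:E)%E.
Proof.
move=> mD Dt mf f0; have mEf : measurable_fun D (EFin \o f).
  by apply/measurable_EFinP; exact: measurable_funTS.
rewrite ge0_integral_measure_sum//.
rewrite -sumEFin; apply: eq_bigr => i _.
rewrite ge0_integral_mscale//.
by rewrite integral_dirac//= inord_val diracE mem_set// mul1e -EFinM.
Qed.

Let nuE (D : set (measurableTypeR R)) : measurable D -> (forall i, D (t i)) ->
  nu D = 1%E.
Proof.
move=> mD Dt; have := @ge0_integral_nu D (fun=> 1) mD Dt.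
rewrite integral_cst// mul1e => H; rewrite [LHS]H//.
by under eq_bigr do rewrite mulr1; rewrite w1.
Qed.

HB.instance Definition _ := Measure_isProbability.Build _ _ _ atomic_measure
  (nuE measurableT (fun=> I)).

Definition atomic_probability : probability (measurableTypeR R) R := atomic_measure.

Hypothesis t01 : forall i, 0 <= t i <= 1.

Lemma atomic_probability_itv : atomic_probability `[0, 1]%classic = 1%E.
Proof. by apply: nuE => [|i]; [exact: measurable_itv|rewrite /= in_itv/=]. Qed.

Lemma atomic_probability_moment j :
  (\int[atomic_probability]_(x in `[0%R, 1%R]) (x ^+ j)%:E =
   (\sum_i w i * t i ^+ j)%:E)%E.
Proof.
apply: (@ge0_integral_nu _ (fun x => x ^+ j)).
- exact: measurable_itv.
- by move=> i; rewrite /= in_itv/=.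
- exact: measurable_funX.
- by move=> x; rewrite /= in_itv/= => /andP[x0 _]; exact: exprn_ge0.
Qed.

End atomic_probability.

Section moment_space_canonical.
Context {R : realType}.
Implicit Types (p s : seq R).

(** Past its end [s] is continued by zeros, so the chain is finite and [chain_quadrature] applies;
    the moment of order 0 says that the weights sum to 1. The closed interval covers the two ends of
    a moment range, where the last canonical moment is 0 or 1. *)
Lemma moment_space_canon n s : (forall c, c \in s -> 0 <= c <= 1) ->
  moment_space [tuple canon_moment s i.+1 | i < n].
Proof.
move=> s01.
have c01 i : 0 <= canon_seq s i <= 1.
  case: i => [|i]; rewrite /canon_seq/= ?lexx ?ler01//.
  have [i_s|s_i] := ltnP i (size s); first exact/s01/mem_nth.
  by rewrite nth_default// lexx ler01.
have cN i : (size s < i)%N -> canon_seq s i = 0.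
  by case: i => // i si; rewrite /canon_seq/= nth_default.
have [t [w [w0 t01 tw]]] := chain_quadrature (erefl _) c01 cN.
have w1 : \sum_i w i = 1.
  by have := tw 0%N; under eq_bigr do rewrite expr0 mulr1; move=> /= <-.
exists (atomic_probability t w0 w1); split; first exact: atomic_probability_itv.
by move=> j; rewrite atomic_probability_moment// tnth_mktuple /canon_moment tw.
Qed.

(* The entry i.-1 of a tuple is the moment of order i, whereas canon_moment is
   indexed by the order. *)
Lemma moment_space_bounds n (m : n.-tuple R) p a :
  (size p < n)%N ->
  moment_space m ->
  (forall j, (j <= size p)%N -> nth 0 m j = canon_moment (rcons p a) j.+1) ->
  0 <= moment_len p * a /\ 0 <= moment_len p * (1 - a).
Proof.
move=> pn [mu [mu1 mum]] mp; apply: (@canon_moment_bounds R mu) => -[_|j].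
  under eq_integral do rewrite expr0.
  by rewrite integral_cst ?mul1e ?mu1//; exact: measurable_itv.
rewrite ltnS => jp; have jn : (j < n)%N by exact: leq_ltn_trans pn.
by rewrite -mp// -(mum (Ordinal jn)) (tnth_nth 0).
Qed.

End moment_space_canonical.

(** * The range of the next moment *)

Section canonical_moments_fwd.
Context {R : realType} (N : nat) (c : N.-tuple R).
Hypothesis c01 : open_cube c.

Let m : N.-tuple R := [tuple of tri_fwd moment_lo moment_len [::] c].

Let c01_take k x : x \in take k c -> 0 < x < 1.
Proof. by move=> /mem_take/tnthP[i ->]. Qed.

Let nth_m j : (j < N)%N -> nth 0 m j = canon_moment c j.+1.
Proof. by move=> jN; rewrite nth_moment_fwd// size_tuple. Qed.

Lemma moment_space_fwd : moment_space m.
Proof.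
rewrite (_ : m = [tuple canon_moment c i.+1 | i < N]).
  by apply: moment_space_canon => x /tnthP[i ->]; have /andP[/ltW-> /ltW->] := c01 i.
by apply: eq_from_tnth => i; rewrite tnth_mktuple (tnth_nth 0) nth_m.
Qed.

Section range.
Variable k : nat.
Hypothesis kN : (k < N)%N.
Let p := take k c.

Let size_p : size p = k. Proof. by rewrite size_takel// size_tuple ltnW. Qed.

Let len_gt0 : 0 < moment_len p.
Proof. by apply: moment_len_gt0 => x; exact: c01_take. Qed.

Let nth_mE r j : (j < k)%N -> nth 0 m j = canon_moment (rcons p r) j.+1.
Proof.
move=> jk; rewrite nth_m ?(ltn_trans jk)//; apply: eq_canon_moment => -[//|i] ij.
by rewrite /canon_seq/= nth_rcons size_p (leq_trans ij)// nth_take// (leq_trans ij).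
Qed.

(** The slope [moment_len p] is positive, so every real [r] is the affine value at some [a]; the
    bounds force [a] into [0, 1], and quadrature realises every such [a]. *)
Lemma moment_range_fwd r :
  moment_range m k r <-> moment_lo p <= r <= moment_lo p + moment_len p.
Proof.
have [a rE] : exists a, r = moment_lo p + moment_len p * a.
  exists ((r - moment_lo p) / moment_len p).
  by rewrite mulrC divfK ?gt_eqF// addrC subrK.
set m' := [tuple if (i < k)%N then nth 0 m i else r | i < k.+1].
have m'E j : (j <= k)%N -> nth 0 m' j = canon_moment (rcons p a) j.+1.
  move=> jk; rewrite -[j]/(val (Ordinal (jk : (j < k.+1)%N))) -tnth_nth tnth_mktuple/=.
  case: ltnP => kj; first exact: nth_mE.
  have -> : j = k by apply/eqP; rewrite eqn_leq jk.
  by have := canon_moment_rcons p a; rewrite size_p => ->.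
rewrite /moment_range/= -/m'; split.
  move=> /(@moment_space_bounds _ _ _ p a); rewrite size_p ltnS => /(_ (leqnn _) m'E).
  by rewrite !pmulr_rge0// rE lerDl pmulr_rge0// lerD2l ger_pMr// subr_ge0 => -[-> ->].
rewrite rE lerDl pmulr_rge0// lerD2l ger_pMr// => /andP[a0 a1].
have -> : m' = [tuple canon_moment (rcons p a) i.+1 | i < k.+1].
  apply: eq_from_tnth => i; rewrite (tnth_nth 0) m'E ?tnth_mktuple//.
  by rewrite -ltnS.
apply: moment_space_canon => x; rewrite mem_rcons inE => /predU1P[->|/c01_take].
  by rewrite a0.
by move=> /andP[/ltW-> /ltW->].
Qed.

Lemma set_min_moment_range : set_min (moment_range m k) = moment_lo p.
Proof.
have lo_in : (moment_range m k `&` lbound (moment_range m k)) (moment_lo p).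
  split; first by apply/moment_range_fwd; rewrite lexx lerDl ltW.
  by move=> r /moment_range_fwd/andP[].
have [/moment_range_fwd/andP[lo1 _]] := getPex (ex_intro _ _ lo_in).
rewrite -/(set_min _) in lo1 *.
by move=> /(_ _ lo_in.1) lo2; apply/eqP; rewrite eq_le lo2.
Qed.

Lemma set_max_moment_range :
  set_max (moment_range m k) = moment_lo p + moment_len p.
Proof.
have hi_in : (moment_range m k `&` ubound (moment_range m k))
    (moment_lo p + moment_len p).
  split; first by apply/moment_range_fwd; rewrite lexx lerDl ltW.
  by move=> r /moment_range_fwd/andP[].
have [/moment_range_fwd/andP[_ hi1]] := getPex (ex_intro _ _ hi_in).
rewrite -/(set_max _) in hi1 *.
by move=> /(_ _ hi_in.1) hi2; apply/eqP; rewrite eq_le hi1.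
Qed.

End range.

Lemma canonical_moments_fwd : canonical_moments m = c.
Proof.
apply: eq_from_tnth => i; rewrite tnth_mktuple.
rewrite set_min_moment_range// set_max_moment_range//.
have -> : tnth m i = moment_lo (take i c) + moment_len (take i c) * tnth c i.
  by rewrite !(tnth_nth 0) nth_tri_fwd// size_tuple.
have len0 : 0 < moment_len (take i c).
  by apply: moment_len_gt0 => x; exact: c01_take.
(* The first canonical moment is defined separately as m_1. This agrees with the general formula
   because the empty prefix has lower end 0 and length 1. *)
case: ifPn => [/eqP->|_]; last first.
  by rewrite [X in X / _]addrC addKr [X in _ / X]addrC addKr mulrC mulKf ?gt_eqF.
rewrite take0 /moment_len big_nil mul1r /moment_lo /canon_moment/= /chain /canon_seq/=.
ring.
Qed.

End canonical_moments_fwd.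

(** * Regularity of the triangular map and its inverse *)

Section polynomial_closure.
Context {R : realType} (T : Type) (K : (T -> R) -> Prop).
Hypothesis Kcst : forall a, K (fun=> a).
Hypothesis KD : forall f g, K f -> K g -> K (fun x => f x + g x).
Hypothesis KM : forall f g, K f -> K g -> K (fun x => f x * g x).
Variables (s : T -> seq R) (n : nat).
Hypothesis sn : forall x, size (s x) = n.
Hypothesis Ks : forall i, K (fun x => nth 0 (s x) i).

Let Ksub f : K f -> K (fun x => 1 - f x).
Proof.
move=> Kf; have := KD (Kcst 1) (KM (Kcst (-1)) Kf).
by congr K; apply/funext => x; rewrite mulN1r.
Qed.

(** [moment_lo] is a polynomial in the entries. The class [K] is abstract because the result serves
    twice: for measurable functions and for functions continuous at a point. *)
Lemma closed_moment_lo : K (fun x => moment_lo (s x)).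
Proof.
have Kc i : K (fun x => canon_seq (s x) i) by case: i => [|i]; [exact: Kcst|exact: Ks].
have Kz i : K (fun x => chain (canon_seq (s x)) i) by apply: KM => //; exact: Ksub.
rewrite (_ : (fun x => _) = (fun x => canon_moment (s x) n.+1)); last first.
  by apply/funext => x; rewrite /moment_lo sn.
rewrite /canon_moment; elim: n.+1.*2 0%N => [|j IHj] k /=; first exact: Kcst.
by apply: KD => //; exact: KM.
Qed.

Lemma closed_prod (g : R -> R) : (forall f, K f -> K (fun x => g (f x))) ->
  K (fun x => \prod_(c <- s x) g c).
Proof.
move=> Kg; rewrite (_ : (fun x => _) = (fun x => \prod_(i < n) g (nth 0 (s x) i))).
  elim: n => [|m IHm]; first by under eq_fun do rewrite big_ord0; exact: Kcst.
  by under eq_fun do rewrite big_ord_recr; apply: KM => //; exact: Kg.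
by apply/funext => x; rewrite (big_nth 0) sn big_mkord.
Qed.

Lemma closed_moment_len : K (fun x => moment_len (s x)).
Proof. by apply: closed_prod => f Kf; apply: KM => //; exact: Ksub. Qed.

End polynomial_closure.

Section measurable_moments.
Context {R : realType}.

Lemma measurable_moment_lo d (T : measurableType d) k (s : T -> seq R) :
  measurable_seq k s -> measurable_fun setT (fun z => moment_lo (s z)).
Proof.
move=> [sk ms]; apply: (closed_moment_lo (K := measurable_fun setT) _ _ _ sk ms).
- by move=> a; exact: measurable_cst.
- by move=> f g; exact: measurable_funD.
- by move=> f g; exact: measurable_funM.
Qed.

Lemma measurable_moment_len d (T : measurableType d) k (s : T -> seq R) :
  measurable_seq k s -> measurable_fun setT (fun z => moment_len (s z)).
Proof.
move=> [sk ms]; apply: (closed_moment_len (K := measurable_fun setT) _ _ _ sk ms).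
- by move=> a; exact: measurable_cst.
- by move=> f g; exact: measurable_funD.
- by move=> f g; exact: measurable_funM.
Qed.

End measurable_moments.

Section continuity.
Context {R : realType} (T : topologicalType) (x0 : T).
Implicit Types (s : T -> seq R).

Let K (f : T -> R) := f z @[z --> x0] --> f x0.

Let continuous_seq n s :=
  (forall z, size (s z) = n) /\ forall i, K (fun z => nth 0 (s z) i).

(** The inverse divides by the lengths, so continuity at [x0] asks for nonzero lengths at that
    point. *)
Lemma continuous_tri_inv k n s (x : T -> seq R) : continuous_seq k s -> continuous_seq n x ->
  (forall j, (j < n)%N ->
    moment_len (s x0 ++ take j (tri_inv moment_lo moment_len (s x0) (x x0))) != 0) ->
  continuous_seq n (fun z => tri_inv moment_lo moment_len (s z) (x z)).
Proof.
have Kcst a : K (fun=> a) by exact: cvg_cst.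
have KD f g : K f -> K g -> K (fun x => f x + g x) by exact: cvgD.
have KM f g : K f -> K g -> K (fun x => f x * g x) by exact: cvgM.
elim: n k s x => [|n IHn] k s x Cs Cx lenj.
  have [sx _] := Cx; rewrite (_ : (fun z => _) = (fun z => [::])).
    by split=> // i; under eq_fun do rewrite nth_nil; exact: Kcst.
  by apply/funext => z; rewrite (size0nil (sx z)).
have [[sk Ks] [sx Kx]] := (Cs, Cx).
pose c z := (nth 0 (x z) 0 - moment_lo (s z)) / moment_len (s z).
have xE z : x z = nth 0 (x z) 0 :: behead (x z) by have := sx z; case: (x z).
have Kc : K c.
  apply: cvgM.
    by apply: cvgB; [exact: Kx|exact: closed_moment_lo sk Ks].
  apply: cvgV; first by have := lenj 0%N isT; rewrite take0 cats0.
  exact: closed_moment_len sk Ks.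
have IH : continuous_seq n (fun z =>
    tri_inv moment_lo moment_len (rcons (s z) (c z)) (behead (x z))).
  apply: (IHn k.+1).
  - split=> [z|i]; first by rewrite size_rcons sk.
    under eq_fun do rewrite nth_rcons sk.
    case: ltngtP => _; [exact: Ks|exact: Kcst|exact: Kc].
  - split=> [z|i]; first by rewrite size_behead sx.
    by under eq_fun do rewrite nth_behead; exact: Kx.
  - move=> j jn; have := lenj j.+1 jn; rewrite {1}xE /= -/(c x0) cat_rcons.
    by [].
rewrite (_ : (fun z => _) = (fun z => c z ::
    tri_inv moment_lo moment_len (rcons (s z) (c z)) (behead (x z)))); last first.
  by apply/funext => z; rewrite {1}xE.
have [IH1 IH2] := IH; split=> [z|[|i]]; [by rewrite /= IH1|exact: Kc|exact: IH2].
Qed.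

End continuity.

Lemma nth_tri_inv (R : realType) (lo len : seq R -> R) p x k : (k < size x)%N ->
  nth 0 (tri_inv lo len p x) k =
  (nth 0 x k - lo (p ++ take k (tri_inv lo len p x))) /
    len (p ++ take k (tri_inv lo len p x)).
Proof.
elim: x p k => [//|a x IHx] p [|k] /=; first by rewrite cats0.
by rewrite ltnS => /IHx->; rewrite cat_rcons.
Qed.

(** * The moment space in canonical coordinates *)

Section moment_space_measure.
Context {R : realType} (N : nat).

Definition moment_inv (m : N.-tuple R) : N.-tuple R :=
  [tuple of tri_inv moment_lo moment_len [::] m].

Definition moment_fwd (c : N.-tuple R) : N.-tuple R :=
  [tuple of tri_fwd moment_lo moment_len [::] c].

Lemma moment_len_take (c : N.-tuple R) k : open_cube c ->
  0 < moment_len (take k c).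
Proof. by move=> c01; apply: moment_len_gt0 => x /mem_take/tnthP[i ->]. Qed.

Lemma moment_invK (m : N.-tuple R) : open_cube (moment_inv m) ->
  moment_fwd (moment_inv m) = m.
Proof.
move=> c01; apply: val_inj; apply: tri_invK => k _.
by rewrite cat0s gt_eqF// (moment_len_take k c01).
Qed.

Lemma canonical_moments_inv (m : N.-tuple R) : open_cube (moment_inv m) ->
  canonical_moments m = moment_inv m.
Proof.
by move=> c01; rewrite -{1}(moment_invK c01); exact: canonical_moments_fwd.
Qed.

Lemma open_cube_moment_space (m : N.-tuple R) : open_cube (moment_inv m) ->
  moment_space m.
Proof. by move=> c01; rewrite -(moment_invK c01); exact: moment_space_fwd. Qed.

(** All lengths are positive at [m], so the inverse map is continuous there and sends nearby points
    into the open cube, which places them in the moment space. *)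
Lemma open_cube_interior (m : N.-tuple R) : open_cube (moment_inv m) ->
  interior_Rn (@moment_space R N) m.
Proof.
move=> c01; pose x (v : 'rV[R]_N) : N.-tuple R := [tuple v 0 i | i < N].
pose v0 : 'rV[R]_N := \row_i tnth m i.
have v0_filter := nbhs_filter v0.
have xv0 : x v0 = m by apply: eq_from_tnth => i; rewrite tnth_mktuple mxE.
have [|||_ Ci] := @continuous_tri_inv R 'rV[R]_N v0 0 N (fun=> [::]) x.
- by split=> // i; rewrite nth_nil; apply: cvg_cst.
- split=> [v|i]; first by rewrite size_tuple.
  have [Ni|iN] := leqP N i.
    have x0 v : nth 0 (x v) i = 0 by rewrite nth_default ?size_tuple.
    by under eq_fun do rewrite x0; rewrite x0; apply: cvg_cst.
  have xE v : nth 0 (x v) i = v 0 (Ordinal iN).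
    by rewrite -[i]/(val (Ordinal iN)) -tnth_nth tnth_mktuple.
  under eq_fun do rewrite xE.
  by rewrite xE; exact: coord_continuous.
- by move=> j _; rewrite cat0s xv0 gt_eqF// (moment_len_take j c01).
suff : \forall v \near v0, forall i, 0 < tnth (moment_inv (x v)) i < 1.
  by apply: filterS => v /open_cube_moment_space.
apply: (@filter_forall _ _ (fun i v => 0 < tnth (moment_inv (x v)) i < 1)
  (nbhs v0) v0_filter) => i.
have := Ci i; rewrite xv0 => Ci0.
have /andP[ci0 ci1] := c01 i; rewrite (tnth_nth 0)/= in ci0 ci1.
have h0 := cvgr_gt _ Ci0 _ ci0; have h1 := cvgr_lt _ Ci0 _ ci1.
near=> v; rewrite (tnth_nth 0)/=; apply/andP; split; near: v; [exact: h0|exact: h1].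
Unshelve. all: by end_near. Qed.

(** The condition concerns the prefix before [k] alone, because the induction of [moment_space_sub]
    does not yet control the later coordinates. *)
Lemma nth_moment_inv (m : N.-tuple R) k : (k < N)%N ->
  moment_len (take k (moment_inv m)) != 0 ->
  nth 0 m k = canon_moment (take k.+1 (moment_inv m)) k.+1.
Proof.
move=> kN len0; set c := moment_inv m in len0 *.
have kc : (k < size c)%N by rewrite size_tuple.
have sp : size (take k c) = k by rewrite size_takel// ltnW.
have := canon_moment_rcons (take k c) (nth 0 c k).
rewrite sp -take_nth// => ->.
have -> : nth 0 c k = (nth 0 m k - moment_lo (take k c)) / moment_len (take k c).
  by rewrite /c /= nth_tri_inv ?size_tuple.
by rewrite mulrC divfK// addrC subrK.
Qed.

(** Off the faces the coordinates are treated in order: those before [k] lie in (0, 1), so the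
    length at [k] is positive and can be divided out of the bounds. These put the coordinate in
    [0, 1], and the endpoints are excluded. *)
Lemma moment_space_sub (m : N.-tuple R) : moment_space m ->
  open_cube (moment_inv m) \/ cube_faces (moment_inv m).
Proof.
move=> mM; have [faces|nfaces] := pselect (cube_faces (moment_inv m)); [by right|left].
set c := moment_inv m in nfaces *.
suff c01 k (kN : (k < N)%N) : 0 < nth 0 c k < 1.
  by move=> i; rewrite (tnth_nth 0) c01.
elim/ltn_ind: k kN => k IHk kN.
have pc j : (j <= k)%N -> 0 < moment_len (take j c).
  move=> jk; apply: moment_len_gt0 => x /(nthP 0)[i].
  rewrite size_takel ?size_tuple ?(leq_trans jk (ltnW kN))// => ij <-.
  rewrite nth_take// IHk ?(leq_trans ij)//; lia.
have sp : size (take k c) = k by rewrite size_takel// size_tuple ltnW.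
have [||c0 c1] := @moment_space_bounds R N m (take k c) (nth 0 c k) _ mM.
- by rewrite sp.
- rewrite sp => j jk; rewrite nth_moment_inv; last 2 first.
  + exact: leq_ltn_trans kN.
  + by rewrite gt_eqF// pc.
  apply: eq_canon_moment => -[//|i] ij; rewrite /canon_seq/= -take_nth ?size_tuple//.
  by rewrite !nth_take// (leq_trans ij).
rewrite !pmulr_rge0 ?subr_ge0 ?pc// in c0 c1.
have cE : nth 0 c k = tnth c (Ordinal kN) by rewrite (tnth_nth 0).
rewrite !lt_neqAle c0 c1 !andbT; apply/andP; split; apply/eqP => ck; apply: nfaces;
  exists (Ordinal kN); rewrite -cE; [by left|by right].
Qed.

End moment_space_measure.

(** * Beta and Gamma integrals *)

Section beta_gamma.
Context {R : realType}.
Local Notation mu := (@lebesgue_measure R).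

(** Extended by 0 so that substitutions and Tonelli act on the whole line. *)
Definition gamma_weight (a t : R) : R :=
  if 0 < t then t `^ (a - 1) * expR (- t) else 0.

Definition beta_weight (a b y : R) : R :=
  if 0 < y < 1 then y `^ (a - 1) * (1 - y) `^ (b - 1) else 0.

Lemma gamma_weight_ge0 a t : 0 <= gamma_weight a t.
Proof. by rewrite /gamma_weight; case: ifPn => // _; rewrite mulr_ge0 ?powR_ge0 ?expR_ge0. Qed.

Lemma beta_weight_ge0 a b y : 0 <= beta_weight a b y.
Proof. by rewrite /beta_weight; case: ifPn => // _; rewrite mulr_ge0 ?powR_ge0. Qed.

Lemma measurable_gamma_weight a : measurable_fun [set: R] (gamma_weight a).
Proof.
apply: measurable_fun_ifT => //; first exact: measurable_fun_ltr.
apply: measurable_funM; first exact: measurable_powR.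
exact: (measurableT_comp (@measurable_expR R)).
Qed.

Lemma measurable_beta_weight a b : measurable_fun [set: R] (beta_weight a b).
Proof.
apply: measurable_fun_ifT => //.
  by apply: measurable_and; exact: measurable_fun_ltr.
apply: measurable_funM; first exact: measurable_powR.
apply: (measurableT_comp (measurable_powR (b - 1))); exact: measurable_funB.
Qed.

Local Open Scope ereal_scope.

Let eG a := \int[mu]_t (gamma_weight a t)%:E.
Let eB a b := \int[mu]_y (beta_weight a b y)%:E.

Let mEG a : measurable_fun [set: R] (EFin \o gamma_weight a).
Proof. by apply/measurable_EFinP; exact: measurable_gamma_weight. Qed.

Let mEB a b : measurable_fun [set: R] (EFin \o beta_weight a b).
Proof. by apply/measurable_EFinP; exact: measurable_beta_weight. Qed.

Let gamma_beta_weight a b u y : (0 < u)%R ->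
  (u * (gamma_weight a (u * y) * gamma_weight b (u - u * y)) =
   gamma_weight (a + b) u * beta_weight a b y)%R.
Proof.
move=> u0; rewrite /gamma_weight /beta_weight u0 pmulr_rgt0//.
have -> : (u - u * y = u * (1 - y))%R by ring.
rewrite pmulr_rgt0// subr_gt0; case: (ltP 0%R y) => y0 /=; last by rewrite mul0r !mulr0.
case: ltP => y1; last by rewrite !mulr0.
have yn0 : (0 <= 1 - y)%R by rewrite subr_ge0 ltW.
rewrite !powRM ?(ltW u0) ?(ltW y0)//.
have -> : (a + b - 1 = 1 + (a - 1) + (b - 1))%R by ring.
rewrite (@powRD _ u (1 + (a - 1))) ?(gt_eqF u0) ?implybT//.
rewrite (@powRD _ u 1) ?(gt_eqF u0) ?implybT// powRr1 ?(ltW u0)//.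
have -> : (- u = - (u * y) + - (u * (1 - y)))%R by ring.
by rewrite expRD; ring.
Qed.

(** Convolution of two Gamma densities: the second variable is replaced by the sum [u], the
    integrals are exchanged, and the first variable is scaled to [u * y]. The identity lives in
    [0, +oo]; finiteness is extracted from it afterwards. *)
Lemma gamma_beta a b : eG a * eG b = eB a b * eG (a + b).
Proof.
have G0 c t : 0 <= (gamma_weight c t)%:E by rewrite lee_fin gamma_weight_ge0.
pose F (z : measurableTypeR R * measurableTypeR R) :=
  (gamma_weight a z.1 * gamma_weight b (z.2 - z.1))%:E.
have F0 z : 0 <= F z by rewrite /F EFinM mule_ge0.
have mF : measurable_fun setT F.
  apply/measurable_EFinP; apply: measurable_funM.
    exact: (measurableT_comp (measurable_gamma_weight a) measurable_fst).
  apply: (measurableT_comp (measurable_gamma_weight b)).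
  exact: measurable_funB.
have mF1 u : measurable_fun [set: R] (fun t => F (t, u)).
  exact: (measurableT_comp mF (pair2_measurable u)).
have mF2 t : measurable_fun [set: R] (fun u => F (t, u)).
  exact: (measurableT_comp mF (pair1_measurable t)).
transitivity (\int[mu]_t \int[mu]_u F (t, u)).
  rewrite -ge0_integralZr//; [|exact: mEG|exact: integral_ge0].
  apply: eq_integral => t _; rewrite -ge0_integralZl; last 4 first.
  - exact: measurableT.
  - exact: mEG.
  - by move=> u _; exact: G0.
  - exact: G0.
  rewrite [RHS](ge0_integral_affine t (oner_neq0 R))//.
  rewrite normr1 mul1e; apply: eq_integral => u _.
  by rewrite /F/= mul1r addrK EFinM.
transitivity (\int[mu]_u \int[mu]_t F (t, u)).
  exact: (@fubini_tonelli _ _ _ _ R mu mu F mF F0).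
rewrite -ge0_integralZl//; [|exact: mEG|].
  2: by apply: integral_ge0 => y _; rewrite lee_fin beta_weight_ge0.
apply: eq_integral => u _; have [u0|u0] := ltP 0%R u; last first.
  rewrite [in RHS]/gamma_weight ltNge u0/= mule0.
  apply: integral0_eq => t _; rewrite /F/= /gamma_weight.
  case: ifPn => t0; last by rewrite mul0r.
  by rewrite ifF ?mulr0//; apply/negbTE; rewrite -leNgt subr_le0 (le_trans u0)// ltW.
rewrite (ge0_integral_affine 0 (lt0r_neq0 u0)); last 2 first.
- exact: mF1.
- by move=> t; exact: F0.
rewrite gtr0_norm// -ge0_integralZl ?lee_fin ?(ltW u0)//; last first.
  apply: (measurableT_comp (mF1 u)).
  by apply: measurable_funD => //; exact: measurable_funM.
rewrite muleC -ge0_integralZl//; last 2 first.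
- exact: mEB.
- by move=> y _; rewrite lee_fin beta_weight_ge0.
apply: eq_integral => y _.
by rewrite /F/= addr0 -!EFinM gamma_beta_weight.
Qed.

Lemma integral_gamma_weight1 : eG 1 = 1.
Proof.
rewrite -(integral_exponential_pdf (ltr01 : 0 < 1 :> R)%R).
apply: ge0_ae_eq_integral => //.
- exact: mEG.
- by apply/measurable_EFinP; exact: measurable_exponential_pdf.
- by move=> t _; rewrite lee_fin gamma_weight_ge0.
- by move=> t _; rewrite lee_fin exponential_pdf_ge0.
exists [set 0%R]; split; [exact: measurable_set1|exact: lebesgue_measure_set1|].
move=> t /=; apply: contra_notP => /eqP t0 _.
rewrite /gamma_weight subrr powRr0 mul1r; case: (ltP 0%R t) => [t_gt0|t_le0].
  by rewrite exponential_pdfE ?ltW// mul1r mulN1r.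
by rewrite lt0_exponential_pdf// lt_neqAle t0.
Qed.

(** The substitution y = x ^ 2 leads to the Gaussian integral. The value shows that Gamma at 1/2 is
    positive and finite. *)
Lemma integral_gamma_weight_half : eG 2^-1 = (Num.sqrt pi)%:E.
Proof.
have Gi : eG 2^-1 = \int[mu]_(y in `]0%R, +oo[) (gamma_weight 2^-1 y)%:E.
  rewrite [RHS]integral_mkcond; apply: eq_integral => y _.
  rewrite patchE; case: ifPn => //; rewrite notin_setE/= in_itv/= andbT => /negP y0.
  by rewrite /gamma_weight (negbTE y0).
rewrite Gi ge0_integral_sqr; [|exact: mEG|]; last first.
  by move=> y; rewrite lee_fin gamma_weight_ge0.
transitivity (2%:E * \int[mu]_(x in `]0%R, +oo[) (gauss_fun x)%:E).
  rewrite -ge0_integralZl//; last 2 first.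
  - by apply/measurable_EFinP/measurable_funTS; exact: measurable_gauss_fun.
  - by move=> x _; rewrite lee_fin gauss_fun_ge0.
  apply: eq_integral => x; rewrite inE/= in_itv/= andbT => x0.
  rewrite -!EFinM /gamma_weight exprn_gt0//; congr EFin.
  have -> : (2^-1 - 1 = - 2^-1 :> R)%R by field.
  rewrite powRN powR12_sqrt ?sqr_ge0// sqrtr_sqr gtr0_norm// /gauss_fun.
  by field; rewrite gt_eqF.
rewrite integral_itv_obnd_cbnd; last first.
  by apply/measurable_EFinP/measurable_funTS; exact: measurable_gauss_fun.
by rewrite integral0y_gauss -EFinM; congr EFin; field.
Qed.

Let pos (x : \bar R) := 0 < x /\ x < +oo.

(** Applied to [gamma_beta], this carries positivity and finiteness from known Gamma values to the
    Beta integral and to Gamma of the sum, without estimating any integral. *)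
Let pos_mul (x y z t : \bar R) : pos x -> pos y -> 0 <= z -> 0 <= t ->
  x * y = z * t -> pos z /\ pos t.
Proof.
move=> [x0 xoo] [y0 yoo] z0 t0 xyzt.
have xy0 : 0 < z * t by rewrite -xyzt mule_gt0.
have xyoo : z * t < +oo by rewrite -xyzt; apply: lte_mul_pinfty; rewrite ?(ltW x0)// ge0_fin_numE ?(ltW x0).
have {}z0 : 0 < z.
  by rewrite lt_def z0 andbT; apply: contraTneq xy0 => ->; rewrite mul0e ltxx.
have {}t0 : 0 < t.
  by rewrite lt_def t0 andbT; apply: contraTneq xy0 => ->; rewrite mule0 ltxx.
split; split=> //; rewrite ltey; apply: contraTneq xyoo => ->.
  by rewrite gt0_mulye.
by rewrite gt0_muley.
Qed.

Let pos_div (x y z t : \bar R) : pos x -> pos y -> 0 <= z -> 0 <= t ->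
  x * y = z * t -> z = (fine x * fine y / fine t)%:E.
Proof.
move=> xp yp z0 t0 xyzt; have [zp tp] := pos_mul xp yp z0 t0 xyzt.
have fin u : pos u -> u \is a fin_num by move=> [u0 uoo]; rewrite ge0_fin_numE// ltW.
rewrite -fineM ?fin// xyzt fineM ?fin// mulfK ?fineK ?fin//.
by rewrite gt_eqF// fine_gt0//; case: tp => -> ->.
Qed.

Let G_ge0 a : 0 <= eG a.
Proof. by apply: integral_ge0 => t _; rewrite lee_fin gamma_weight_ge0. Qed.

Let B_ge0 a b : 0 <= eB a b.
Proof. by apply: integral_ge0 => t _; rewrite lee_fin beta_weight_ge0. Qed.

Let G_nat n : pos (eG n.+1%:R).
Proof.
have p1 : pos (eG 1) by rewrite integral_gamma_weight1; split; rewrite ?lte01 ?ltry.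
elim: n => [//|n IHn]; have := gamma_beta n.+1%:R 1.
by rewrite natr1 => /(pos_mul IHn p1 (B_ge0 _ _) (G_ge0 _))[].
Qed.

Lemma Gamma_funE a : Gamma_fun a = fine (eG a).
Proof.
rewrite /Gamma_fun /Rintegral; congr fine.
rewrite [LHS]integral_mkcond; apply: eq_integral => y _.
rewrite patchE /gamma_weight; case: (ltP 0%R y) => y0.
  by rewrite mem_set//= in_itv/= andbT.
by rewrite memNset//= in_itv/= andbT ltNge y0.
Qed.

Lemma Gamma_fun_ge0 a : (0 <= Gamma_fun a :> R)%R.
Proof. by rewrite Gamma_funE fine_ge0. Qed.

Lemma beta_half n :
  eB 2^-1 n.+1%:R = (Gamma_fun 2^-1 * Gamma_fun n.+1%:R /
                     Gamma_fun (2^-1 + n.+1%:R))%:E /\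
  0 < eB 2^-1 n.+1%:R < +oo.
Proof.
have ph : pos (eG 2^-1).
  by rewrite integral_gamma_weight_half; split; rewrite ?ltry// lte_fin sqrtr_gt0 pi_gt0.
have gb := gamma_beta 2^-1 n.+1%:R.
have [[b0 boo] _] := pos_mul ph (G_nat n) (B_ge0 _ _) (G_ge0 _) gb.
split; last by rewrite b0 boo.
rewrite !Gamma_funE; exact: (pos_div ph (G_nat n) (B_ge0 _ _) (G_ge0 _) gb).
Qed.

End beta_gamma.

(** * One-dimensional densities *)

Section weights.
Context {R : realType}.
Local Notation mu := (@lebesgue_measure R).

(* Density of the canonical moment c_{N-k}, up to a constant. *)
Definition canon_weight (k : nat) (c : R) : R :=
  if 0 < c < 1 then (c * (1 - c)) ^+ k else 0.

(* Density of the squared ball coordinate, up to a constant. *)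
Definition square_weight (k : nat) (y : R) : R := beta_weight 2^-1 k.+1%:R y.

(** The index counts the later coordinates, hence the lengths in the Jacobian that involve the given
    one. It does not change when entries are added in front, which suits induction. *)
Definition tuple_weight (w : nat -> R -> R) n (c : n.-tuple R) : R :=
  \prod_(i < n) w (n - i.+1)%N (tnth c i).

Lemma canon_weight_ge0 k c : 0 <= canon_weight k c.
Proof.
rewrite /canon_weight; case: ifPn => // /andP[c0 c1].
by rewrite exprn_ge0// mulr_ge0 ?subr_ge0// ltW.
Qed.

Lemma square_weight_ge0 k y : 0 <= square_weight k y.
Proof. exact: beta_weight_ge0. Qed.

Lemma measurable_canon_weight k : measurable_fun [set: R] (canon_weight k).
Proof.
apply: measurable_fun_ifT => //.
  by apply: measurable_and; exact: measurable_fun_ltr.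
by apply: measurable_funX; apply: measurable_funM => //; exact: measurable_funB.
Qed.

Lemma measurable_square_weight k : measurable_fun [set: R] (square_weight k).
Proof. exact: measurable_beta_weight. Qed.

Lemma tuple_weight_cons w n (a : R) (c : n.-tuple R) :
  tuple_weight w [tuple of a :: c] = w n a * tuple_weight w c.
Proof.
rewrite /tuple_weight big_ord_recl subn1; congr (_ * _).
by apply: eq_bigr => i _; rewrite tnthS.
Qed.

Lemma tuple_weight_ge0 w n (c : n.-tuple R) : (forall k x, 0 <= w k x) ->
  0 <= tuple_weight w c.
Proof. by move=> w0; exact: prodr_ge0. Qed.

Lemma measurable_tuple_weight w n : (forall k, measurable_fun [set: R] (w k)) ->
  measurable_fun [set: n.-tuple (measurableTypeR R)] (@tuple_weight w n).
Proof.
move=> mw; apply: measurable_prod => i _.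
exact: (measurableT_comp (mw _) (@measurable_tnth _ (measurableTypeR R) n i)).
Qed.

Local Open Scope ereal_scope.

Lemma measurable_sqrt : measurable_fun [set: R] (@Num.sqrt R).
Proof. by apply: continuous_measurable_fun; exact: sqrt_continuous. Qed.

Lemma ge0_integral_symmetrize (G : R -> \bar R) : measurable_fun [set: R] G ->
  (forall x, 0 <= G x) ->
  \int[mu]_x G x = \int[mu]_(x in `]0%R, +oo[) (G x + G (- x)%R).
Proof.
move=> mG G0.
pose P (x : R) := if (0 < x)%R then G x else 0.
pose Q (x : R) := if (x < 0)%R then G x else 0.
have P0 x : 0 <= P x by rewrite /P; case: ifP.
have Q0 x : 0 <= Q x by rewrite /Q; case: ifP.
have mP : measurable_fun [set: R] P.
  by apply: measurable_fun_ifT => //; exact: measurable_fun_ltr.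
have mQ : measurable_fun [set: R] Q.
  by apply: measurable_fun_ifT => //; exact: measurable_fun_ltr.
have mQN : measurable_fun [set: R] (fun x => Q (- x)%R) by exact: measurableT_comp.
transitivity (\int[mu]_x (P x + Q x)).
  apply: ge0_ae_eq_integral => //.
  - exact: emeasurable_funD.
  - by move=> x _; exact: adde_ge0.
  exists [set 0%R]; split; [exact: measurable_set1|exact: lebesgue_measure_set1|].
  move=> x /=; apply: contra_notP => /eqP x0 _; rewrite /P /Q.
  by case: ltgtP x0 => // _ _; rewrite ?adde0 ?add0e.
have N1 : ((-1)%R : R) != 0%R by rewrite oppr_eq0 oner_eq0.
rewrite ge0_integralD// (ge0_integral_affine 0 N1 mQ Q0) normrN1 mul1e.
rewrite -ge0_integralD//; last first.
  apply: (measurableT_comp mQ); apply: measurable_funD => //; exact: measurable_funM.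
rewrite [RHS]integral_mkcond; apply: eq_integral => x _.
rewrite patchE addr0 mulN1r /P /Q oppr_lt0; case: (ltP 0%R x) => x0.
  by rewrite mem_set//= in_itv/= andbT.
by rewrite memNset ?adde0//= in_itv/= andbT ltNge x0.
Qed.

(** With x = 2c - 1, the factor 1/2 is dc = dx / 2, and [4 ^- k] comes from c (1 - c) = (1 - x ^ 2)
    / 4. *)
Definition square_ratio (k : nat) : R := (4 ^- k / 2)%R.

Lemma square_ratio_ge0 k : (0 <= square_ratio k)%R.
Proof. by rewrite /square_ratio divr_ge0// invr_ge0 exprn_ge0. Qed.

(* With x = 2c - 1 and y = x ^ 2, both sides are integrals over (-1, 1) against
   (1 - x ^ 2) ^ k. *)
Lemma integral_canon_square k (h : R -> \bar R) : measurable_fun [set: R] h ->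
  (forall x, 0 <= h x) ->
  \int[mu]_c (h (2 * c - 1)%R * (canon_weight k c)%:E) =
  (square_ratio k)%:E * \int[mu]_y ((2^-1%:E * h (Num.sqrt y) + 2^-1%:E * h (- Num.sqrt y)%R) *
     (square_weight k y)%:E).
Proof.
move=> mh h0.
pose W (x : R) : R := if (-1 < x < 1)%R then ((1 - x ^+ 2) ^+ k)%R else 0%R.
have W0 x : (0 <= W x)%R.
  rewrite /W; case: ifPn => // x1; apply: exprn_ge0; rewrite subr_ge0.
  by rewrite -real_normK ?num_real// expr_le1// ltW// ltr_norml.
have WN x : W (- x)%R = W x.
  by rewrite /W sqrrN; congr (if _ then _ else _); rewrite ltrN2 ltrNl andbC.
have mW : measurable_fun [set: R] W.
  apply: measurable_fun_ifT => //.
    by apply: measurable_and; exact: measurable_fun_ltr.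
  by apply: measurable_funX; apply: measurable_funB => //; exact: measurable_funX.
pose G x := h x * (W x)%:E.
have mG : measurable_fun [set: R] G by apply: emeasurable_funM => //; exact/measurable_EFinP.
have G0 x : 0 <= G x by rewrite mule_ge0// lee_fin.
pose H y := (2^-1%:E * h (Num.sqrt y) + 2^-1%:E * h (- Num.sqrt y)%R) *
     (square_weight k y)%:E.
have H0 y : 0 <= H y.
  by rewrite mule_ge0 ?lee_fin ?square_weight_ge0// adde_ge0// mule_ge0.
have mH : measurable_fun [set: R] H.
  apply: emeasurable_funM; last by apply/measurable_EFinP; exact: measurable_square_weight.
  apply: emeasurable_funD; apply: emeasurable_funM => //.
    exact: (measurableT_comp mh measurable_sqrt).
  exact: (measurableT_comp mh (measurable_funN measurable_sqrt)).
have two0 : (2%R : R) != 0%R by rewrite pnatr_eq0.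
transitivity ((square_ratio k)%:E * \int[mu]_x G x); last congr (_ * _).
  rewrite (ge0_integral_affine (-1)%R two0 mG G0) muleA -EFinM.
  rewrite -ge0_integralZl//.
  - apply: eq_integral => c _; rewrite /G muleCA; congr (_ * _).
    rewrite -EFinM; congr EFin; rewrite /square_ratio ger0_norm// divfK// /canon_weight /W.
    have -> : (-1 < 2 * c - 1 < 1)%R = (0 < c < 1)%R.
      by apply/idP/idP => /andP[c0 c1]; apply/andP; split; lra.
    case: ifP => _; last by rewrite mulr0.
    have -> : (1 - (2 * c - 1) ^+ 2 = 4 * (c * (1 - c)))%R by ring.
    by rewrite [in RHS]exprMn mulKf// expf_neq0// pnatr_eq0.
  - apply: (measurableT_comp mG); apply: measurable_funD => //; exact: measurable_funM.
  - by rewrite lee_fin mulr_ge0// square_ratio_ge0.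
rewrite ge0_integral_symmetrize//.
have -> : \int[mu]_y H y = \int[mu]_(y in `]0%R, +oo[) H y.
  rewrite [RHS]integral_mkcond; apply: eq_integral => y _; rewrite patchE.
  case: ifPn => //; rewrite notin_setE/= in_itv/= andbT => /negP y0.
  by rewrite /H /square_weight /beta_weight (negbTE y0) mule0.
rewrite [RHS]ge0_integral_sqr//; apply: eq_integral => x.
rewrite inE/= in_itv/= andbT => x0.
rewrite /G /H WN -ge0_muleDl// -ge0_muleDr// sqrtr_sqr gtr0_norm//.
rewrite -[RHS]muleA -EFinM -[RHS]muleA [RHS]muleCA -EFinM.
congr (_ * _); congr EFin.
rewrite /W /square_weight /beta_weight exprn_gt0//=.
rewrite expr_lt1// ?ltW// (lt_trans _ x0) ?ltrN10//=.
case: ifPn => x1; last by rewrite ?(mul0r, mulr0).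
have -> : (k.+1%:R - 1 = k%:R :> R)%R by rewrite -natr1 addrK.
rewrite powR_mulrn; last by rewrite subr_ge0 exprn_ile1// ltW.
have -> : (2^-1 - 1 = - 2^-1 :> R)%R by field.
(* For y = x ^ 2 the power y ^ (-1/2) is 1 / x; it cancels the x of dy = 2 x dx, and the remaining 2
   cancels the sign probability 1/2. *)
rewrite powRN powR12_sqrt ?sqr_ge0// sqrtr_sqr gtr0_norm//.
by field; rewrite gt_eqF.
Qed.

End weights.

(** * Random signs *)

Section signed_sqrt.
Context {R : realType}.
Local Notation mu := (@lebesgue_measure R).
Local Notation RT n := (n.-tuple (measurableTypeR R)).
Local Notation coin := (bernoulli_prob (2^-1 : R)).

Definition signed_sqrt n (y : n.-tuple R) (e : n.-tuple bool) : n.-tuple R :=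
  [tuple (-1) ^+ tnth e i * Num.sqrt (tnth y i) | i < n].

Definition double_sub1 n (c : n.-tuple R) : n.-tuple R :=
  [tuple 2 * tnth c i - 1 | i < n].

Lemma signed_sqrt_cons n (a : R) (y : n.-tuple R) (b : bool) (e : n.-tuple bool) :
  signed_sqrt [tuple of a :: y] [tuple of b :: e] =
  [tuple of ((-1) ^+ b * Num.sqrt a) :: signed_sqrt y e].
Proof.
apply: eq_from_tnth => i; rewrite tnth_mktuple.
by case: (unliftP ord0 i) => [j ->|->]//; rewrite !tnthS tnth_mktuple.
Qed.

Lemma double_sub1_cons n (a : R) (c : n.-tuple R) :
  double_sub1 [tuple of a :: c] = [tuple of (2 * a - 1) :: double_sub1 c].
Proof.
apply: eq_from_tnth => i; rewrite tnth_mktuple.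
by case: (unliftP ord0 i) => [j ->|->]//; rewrite !tnthS tnth_mktuple.
Qed.

Lemma measurable_signed_sqrt d (T : measurableType d) n (y : T -> RT n)
    (e : T -> n.-tuple bool) :
  measurable_fun setT y -> measurable_fun setT e ->
  measurable_fun setT (fun z => signed_sqrt (y z) (e z) : RT n).
Proof.
move=> my me; apply/measurable_fun_tnthP => i.
have m1 : measurable_fun setT (fun b : bool => (-1) ^+ b : R).
  by move=> _ Y _; exact: I.
have my1 := measurableT_comp (@measurable_tnth _ (measurableTypeR R) n i) my.
have me1 := measurableT_comp (@measurable_tnth _ bool n i) me.
have := measurable_funM (measurableT_comp m1 me1) (measurableT_comp measurable_sqrt my1).
by congr measurable_fun; apply/funext => z; rewrite /= tnth_mktuple.
Qed.

Lemma measurable_double_sub1 n :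
  measurable_fun setT (fun c : RT n => double_sub1 c : RT n).
Proof.
apply/measurable_fun_tnthP => i.
have mi := @measurable_tnth _ (measurableTypeR R) n i.
have : measurable_fun setT (fun c : RT n => (2 * tnth c i - 1 : R)).
  by apply: measurable_funB => //; exact: measurable_funM.
by congr measurable_fun; apply/funext => z; rewrite /= tnth_mktuple.
Qed.

Local Open Scope ereal_scope.

Definition sign_mean n (f : RT n -> \bar R) (y : RT n) : \bar R :=
  \int[power_measure coin n]_e f (signed_sqrt y e).

Lemma sign_mean_ge0 n (f : RT n -> \bar R) y : (forall x, 0 <= f x) ->
  0 <= sign_mean f y.
Proof. by move=> f0; exact: integral_ge0. Qed.

Lemma measurable_sign_mean n (f : RT n -> \bar R) :
  measurable_fun setT f -> (forall x, 0 <= f x) ->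
  measurable_fun setT (sign_mean f).
Proof.
move=> mf f0.
apply: (@measurable_fun_fubini_tonelli_F _ _ _ _ R (power_measure coin n)
  (fun z => f (signed_sqrt z.1 z.2))) => //.
by apply: measurableT_comp => //; apply: measurable_signed_sqrt.
Qed.

Lemma sign_mean_cons n (f : RT n.+1 -> \bar R) a (y : RT n) :
  measurable_fun setT f -> (forall x, 0 <= f x) ->
  sign_mean f [tuple of a :: y] =
  2^-1%:E * sign_mean (fun x => f [tuple of Num.sqrt a :: x]) y +
  2^-1%:E * sign_mean (fun x => f [tuple of (- Num.sqrt a)%R :: x]) y.
Proof.
move=> mf f0; rewrite /sign_mean ge0_integral_powerS//; last first.
  by apply: measurableT_comp => //; apply: measurable_signed_sqrt.
rewrite integral_bernoulli_prob//=; last 2 first.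
- by rewrite invr_ge0 ler0n invf_le1// ler1n.
- by move=> b; exact: integral_ge0.
rewrite addeC; congr (_ * _ + _ * _).
- by congr EFin; rewrite /unstable.onem; field.
- by apply: eq_integral => e _; rewrite signed_sqrt_cons expr0 mul1r.
- by apply: eq_integral => e _; rewrite signed_sqrt_cons expr1 mulN1r.
Qed.

Let mcons n (x : R) : measurable_fun setT (fun y : RT n => [tuple of x :: y] : RT n.+1).
Proof. exact: measurable_cons. Qed.

Lemma measurable_tupleE n w : (forall k, measurable_fun [set: R] (w k)) ->
  measurable_fun setT (fun y : RT n => (tuple_weight w y)%:E).
Proof. by move=> mw; apply/measurable_EFinP; exact: measurable_tuple_weight. Qed.

(** The induction hypothesis is used under the integral, for a fixed first coordinate; the
    one-dimensional identity is then applied to [h], which integrates out all the others. *)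
Lemma integral_canon_square_tuple n (f : RT n -> \bar R) :
  measurable_fun setT f -> (forall x, 0 <= f x) ->
  \int[lebesgue_Rn n]_c (f (double_sub1 c) * (tuple_weight canon_weight c)%:E) =
  (\prod_(i < n) square_ratio i)%:E *
  \int[lebesgue_Rn n]_y (sign_mean f y * (tuple_weight square_weight y)%:E).
Proof.
have c0 := @canon_weight_ge0 R; have s0 := @square_weight_ge0 R.
have K0 m : (0 <= \prod_(i < m) square_ratio i :> R)%R by apply: prodr_ge0 => i _; exact: square_ratio_ge0.
elim: n f => [|n IHn] f mf f0.
  rewrite !ge0_integral_power0//; last 2 first.
  - by move=> x; rewrite mule_ge0 ?sign_mean_ge0// lee_fin tuple_weight_ge0.
  - by move=> x; rewrite mule_ge0// lee_fin tuple_weight_ge0.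
  rewrite /tuple_weight !big_ord0 mul1e !mule1 /sign_mean ge0_integral_power0//.
  by congr f; apply: eq_from_tnth => -[].
have mfx x : measurable_fun setT (fun y : RT n => f [tuple of x :: y]).
  by apply: measurableT_comp => //; exact: mcons.
rewrite /lebesgue_Rn !ge0_integral_powerS; last 4 first.
- apply: emeasurable_funM; first exact: measurable_sign_mean.
  by apply: measurable_tupleE; exact: measurable_square_weight.
- by move=> x; rewrite mule_ge0 ?sign_mean_ge0// lee_fin tuple_weight_ge0.
- apply: emeasurable_funM.
    by apply: measurableT_comp => //; exact: measurable_double_sub1.
  by apply: measurable_tupleE; exact: measurable_canon_weight.
- by move=> x; rewrite mule_ge0// lee_fin tuple_weight_ge0.
pose F (t : RT n.+1) := sign_mean (fun x => f [tuple of thead t :: x]) [tuple of behead t] *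
  (tuple_weight square_weight [tuple of behead t])%:E.
pose h x := \int[lebesgue_Rn n]_y F [tuple of x :: y].
have F0 t : 0 <= F t by rewrite mule_ge0 ?sign_mean_ge0// lee_fin tuple_weight_ge0.
have mF : measurable_fun setT F.
  apply: emeasurable_funM; last first.
    apply: (measurableT_comp (measurable_tupleE _)); last exact: measurable_behead.
    exact: measurable_square_weight.
  apply: (@measurable_fun_fubini_tonelli_F _ _ _ _ R (power_measure coin n)
    (fun z => f [tuple of thead z.1 :: signed_sqrt [tuple of behead z.1] z.2])) => //.
  apply: measurableT_comp => //; apply: measurable_cons.
    apply: (measurableT_comp (@measurable_tnth _ (measurableTypeR R) n.+1 ord0)).
    exact: measurable_fst.
  apply: measurable_signed_sqrt => //.
  by apply: (measurableT_comp (@measurable_behead _ _ n)); exact: measurable_fst.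
have h0 x : 0 <= h x by exact: integral_ge0.
have mh : measurable_fun [set: R] h by exact: (@measurable_integral_powerS _ _ R mu n F).
have hE x : h x = \int[lebesgue_Rn n]_y
    (sign_mean (fun t => f [tuple of x :: t]) y * (tuple_weight square_weight y)%:E).
  apply: eq_integral => y _; rewrite /F theadE.
  by have -> : [tuple of behead [tuple of x :: y]] = y by exact: val_inj.
transitivity ((\prod_(i < n) square_ratio i)%:E *
    \int[mu]_c (h (2 * c - 1)%R * (canon_weight n c)%:E)).
  rewrite -ge0_integralZl//; last 3 first.
  - apply: emeasurable_funM; last by apply/measurable_EFinP; exact: measurable_canon_weight.
    apply: (measurableT_comp mh); apply: measurable_funB => //; exact: measurable_funM.
  - by move=> c _; rewrite mule_ge0// lee_fin.
  - by rewrite lee_fin.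
  apply: eq_integral => c _; rewrite hE muleA -IHn//.
  rewrite -ge0_integralZr//; last 3 first.
  - apply: emeasurable_funM.
      exact: (measurableT_comp (mfx (2 * c - 1)%R) (@measurable_double_sub1 n)).
    by apply: measurable_tupleE; exact: measurable_canon_weight.
  - by move=> y _; rewrite mule_ge0// lee_fin tuple_weight_ge0.
  - by rewrite lee_fin.
  apply: eq_integral => y _.
  by rewrite double_sub1_cons tuple_weight_cons EFinM -muleA [X in _ * X]muleC.
rewrite integral_canon_square// muleA -EFinM big_ord_recr/=; congr (_ * _).
apply: eq_integral => a _; rewrite !hE.
have m1 x : measurable_fun setT (fun y : RT n =>
    sign_mean (fun t => f [tuple of x :: t]) y * (tuple_weight square_weight y)%:E).
  apply: emeasurable_funM; first exact: measurable_sign_mean.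
  by apply: measurable_tupleE; exact: measurable_square_weight.
have p1 x y : 0 <= sign_mean (fun t => f [tuple of x :: t]) y * (tuple_weight square_weight y)%:E.
  by rewrite mule_ge0 ?sign_mean_ge0// lee_fin tuple_weight_ge0.
rewrite -!ge0_integralZl// -ge0_integralD//; last 4 first.
- by move=> y _; rewrite mule_ge0.
- by apply: emeasurable_funM => //; exact: m1.
- by move=> y _; rewrite mule_ge0.
- by apply: emeasurable_funM => //; exact: m1.
rewrite -ge0_integralZr//; last 3 first.
- by apply: emeasurable_funD; apply: emeasurable_funM => //; exact: m1.
- by move=> y _; rewrite adde_ge0// mule_ge0.
- by rewrite lee_fin.
apply: eq_integral => y _; rewrite sign_mean_cons// tuple_weight_cons.
rewrite [(_ * tuple_weight _ _)%R]mulrC EFinM [RHS]muleA; congr (_ * _).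
have e1 (u v w : \bar R) : 0 <= u -> 0 <= v ->
    (2^-1%:E * u + 2^-1%:E * v) * w = 2^-1%:E * (u * w) + 2^-1%:E * (v * w).
  by move=> u0 v0; rewrite ge0_muleDl ?muleA// mule_ge0.
by apply/esym/e1; exact: sign_mean_ge0.
Qed.

End signed_sqrt.

(** Each entry contributes its [ell] to the length of every later step, whence the exponents;
    nonnegativity removes the absolute values. *)
Lemma tri_jac_prod (R : realType) (len : seq R -> R) (ell : R -> R) p c :
  (forall p a, len (rcons p a) = len p * ell a) -> 0 <= len p ->
  (forall a, a \in c -> 0 <= ell a) ->
  tri_jac len p c =
  len p ^+ size c * \prod_(i < size c) ell (nth 0 c i) ^+ (size c - i.+1).
Proof.
move=> lenE; elim: c p => [|a c IHc] p p0 c0 /=.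
  by rewrite big_ord0 mulr1.
have a0 : 0 <= ell a by apply: c0; rewrite mem_head.
rewrite IHc; last 2 first.
- by rewrite lenE mulr_ge0.
- by move=> x xc; apply: c0; rewrite inE xc orbT.
rewrite lenE ger0_norm// big_ord_recl/= subn1/= exprMn exprS.
by under [in RHS]eq_bigr do rewrite subSS; ring.
Qed.

(** * Stick breaking *)

Section stick_breaking.
Context {R : realType}.
Local Notation RT n := (n.-tuple (measurableTypeR R)).

Definition stick_lo (p : seq R) : R := 0.

Definition stick_len (p : seq R) : R := \prod_(c <- p) (1 - c).

Lemma stick_len_rcons p a : stick_len (rcons p a) = stick_len p * (1 - a).
Proof. by rewrite /stick_len -cats1 big_cat big_seq1. Qed.

Lemma stick_len_nil : stick_len [::] = 1. Proof. exact: big_nil. Qed.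

Lemma stick_len_neq0 p c : stick_len p != 0 -> c != 0 -> c != 1 ->
  stick_len (rcons p c) != 0.
Proof.
by move=> p0 _ c1; rewrite stick_len_rcons mulf_neq0// subr_eq0 eq_sym.
Qed.

Lemma measurable_stick_lo d (T : measurableType d) k (s : T -> seq R) :
  measurable_seq k s -> measurable_fun setT (fun z => stick_lo (s z)).
Proof. by move=> _; exact: measurable_cst. Qed.

Lemma measurable_stick_len d (T : measurableType d) k (s : T -> seq R) :
  measurable_seq k s -> measurable_fun setT (fun z => stick_len (s z)).
Proof.
move=> [sk ms].
apply: (closed_prod (K := measurable_fun setT) _ _ sk ms (g := fun c => 1 - c)).
- by move=> a; exact: measurable_cst.
- by move=> f g; exact: measurable_funM.
- by move=> f mf; exact: measurable_funB.
Qed.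

Lemma stick_len_gt0 p : (forall c, c \in p -> 0 < c < 1) -> 0 < stick_len p.
Proof.
move=> p01; rewrite /stick_len big_seq; apply: prodr_gt0 => c /p01/andP[_ c1].
by rewrite subr_gt0.
Qed.

Lemma sum_stick_fwd p y :
  \sum_(x <- tri_fwd stick_lo stick_len p y) x = stick_len p - stick_len (p ++ y).
Proof.
elim: y p => [|a y IHy] p /=; first by rewrite big_nil cats0 subrr.
by rewrite big_cons IHy -cat_rcons stick_len_rcons /stick_lo; ring.
Qed.

Lemma take_tri_fwd lo len p k (y : seq R) :
  take k (tri_fwd lo len p y) = tri_fwd lo len p (take k y).
Proof. by elim: y p k => [|a y IHy] p [|k]//=; rewrite IHy. Qed.

Lemma stick_inv_cube p (x : seq R) : 0 < stick_len p ->
  (forall b, b \in x -> 0 < b) -> \sum_(b <- x) b < stick_len p ->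
  forall c, c \in tri_inv stick_lo stick_len p x -> 0 < c < 1.
Proof.
elim: x p => [//|b x IHx] p p0 x0; rewrite big_cons => sx c /=.
have b0 : 0 < b by apply: x0; rewrite mem_head.
have x'0 z : z \in x -> 0 < z by move=> zx; apply: x0; rewrite inE zx orbT.
have s0 : 0 <= \sum_(z <- x) z.
  by rewrite big_seq; apply: sumr_ge0 => z /x'0/ltW.
rewrite /stick_lo subr0 inE => /predU1P[->|].
  by rewrite divr_gt0//= ltr_pdivrMr// mul1r; lra.
have lenE : stick_len (rcons p (b / stick_len p)) = stick_len p - b.
  by rewrite stick_len_rcons mulrBr mulr1 [_ * (_ / _)]mulrC divfK// gt_eqF.
by apply: IHx => //; rewrite lenE; lra.
Qed.

Section tuples.
Variable N : nat.

Definition stick_inv (x : N.-tuple R) : N.-tuple R :=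
  [tuple of tri_inv stick_lo stick_len [::] x].

Definition stick_fwd (y : N.-tuple R) : N.-tuple R :=
  [tuple of tri_fwd stick_lo stick_len [::] y].

Lemma stick_len_take (y : N.-tuple R) k : open_cube y -> 0 < stick_len (take k y).
Proof. by move=> y01; apply: stick_len_gt0 => x /mem_take/tnthP[i ->]. Qed.

Lemma stick_invK (x : N.-tuple R) : open_cube (stick_inv x) ->
  stick_fwd (stick_inv x) = x.
Proof.
move=> c01; apply: val_inj; apply: tri_invK => k _.
by rewrite cat0s gt_eqF// (stick_len_take k c01).
Qed.

Lemma tnth_stick_fwd (y : N.-tuple R) (i : 'I_N) :
  tnth (stick_fwd y) i = stick_len (take i y) * tnth y i.
Proof. by rewrite !(tnth_nth 0) nth_tri_fwd ?size_tuple// add0r. Qed.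

Lemma sum_tnth_take (x : N.-tuple R) k :
  \sum_(i < N | (i < k)%N) tnth x i = \sum_(z <- take k x) z.
Proof.
have [kN|Nk] := leqP k N.
  rewrite (big_nth 0) size_takel ?size_tuple// big_mkord.
  rewrite (big_ord_widen_cond _ xpredT (fun i => nth 0 (take k x) i) kN).
  by apply: eq_bigr => i ik; rewrite nth_take// (tnth_nth 0).
rewrite take_oversize ?size_tuple ?(ltnW Nk)// big_tuple.
by apply: eq_bigl => i; rewrite (ltn_trans (ltn_ord i)).
Qed.

Lemma prod_tnth_take (y : N.-tuple R) k :
  \prod_(i < N | (i < k)%N) (1 - tnth y i) = stick_len (take k y).
Proof.
rewrite /stick_len; have [kN|Nk] := leqP k N.
  rewrite (big_nth 0) size_takel ?size_tuple// big_mkord.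
  rewrite (big_ord_widen_cond _ xpredT (fun i => 1 - nth 0 (take k y) i) kN).
  by apply: eq_bigr => i ik; rewrite nth_take// (tnth_nth 0).
rewrite take_oversize ?size_tuple ?(ltnW Nk)// big_tuple.
by apply: eq_bigl => i; rewrite (ltn_trans (ltn_ord i)).
Qed.

Lemma stick_sum_take (y : N.-tuple R) k :
  1 - \sum_(i < N | (i < k)%N) tnth (stick_fwd y) i = stick_len (take k y).
Proof.
by rewrite sum_tnth_take/= take_tri_fwd sum_stick_fwd cat0s stick_len_nil opprB addrCA subrr addr0.
Qed.

Lemma open_simplex_stick (x : N.-tuple R) :
  open_simplex x <-> open_cube (stick_inv x).
Proof.
split=> [[x0 x1] i|c01].
  apply: (@stick_inv_cube [::] x); last exact: mem_tnth.
  - by rewrite stick_len_nil ltr01.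
  - by move=> b /tnthP[j ->].
  - by rewrite stick_len_nil big_tuple.
rewrite -(stick_invK c01); split=> [i|].
  by rewrite tnth_stick_fwd mulr_gt0 ?stick_len_take//; have /andP[] := c01 i.
rewrite -subr_gt0; have := stick_sum_take (stick_inv x) N.
under eq_bigl do rewrite ltn_ord.
by move=> ->; exact: stick_len_take.
Qed.

Lemma measurable_stick_inv : measurable_fun setT (stick_inv : RT N -> RT N).
Proof. exact: (measurable_tri_inv_tuple measurable_stick_lo measurable_stick_len). Qed.

Lemma measurable_stick_fwd : measurable_fun setT (stick_fwd : RT N -> RT N).
Proof. exact: (measurable_tri_fwd_tuple measurable_stick_lo measurable_stick_len). Qed.

Lemma measurable_open_simplex : measurable (@open_simplex R N : set (RT N)).
Proof.
have -> : @open_simplex R N = stick_inv @^-1` (@open_cube R N).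
  by apply/seteqP; split=> x /open_simplex_stick.
rewrite -[X in measurable X]setTI; apply: measurable_stick_inv => //.
exact: measurable_open_cube.
Qed.

(** The inverse canonical coordinate map is a square root of stick breaking: the squares of its
    values depend on the squares of the coordinates alone, and the signs are carried along. *)
Lemma stick_signed_sqrt (y : N.-tuple R) e : open_cube y ->
  canonical_coords_inv (signed_sqrt y e) = signed_sqrt (stick_fwd y) e.
Proof.
move=> y01; apply: eq_from_tnth => k; rewrite !tnth_mktuple tnth_stick_fwd.
have y0 i : 0 <= tnth y i by have /andP[/ltW] := y01 i.
rewrite sqrtrM ?(ltW (stick_len_take _ y01))// -mulrA; congr (_ * _).
rewrite mulrC; congr (Num.sqrt _ * _).
rewrite -prod_tnth_take; apply: eq_bigr => i _; rewrite tnth_mktuple exprMn.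
by rewrite sqr_sqrtr// sqrr_sign mul1r.
Qed.

Let a : nat -> R := fun=> 2^-1.
Let b : nat -> R := fun j => N%:R - j%:R + 1.

(** For these parameters [b N - 1] is 0, and [b j - (a j.+1 + b j.+1)] is 1/2, the opposite of
    [a j.+1 - 1], so the powers of the remaining stick cancel. The powers of [1 - y_j] in the Beta
    densities come from the Jacobian alone. *)
Lemma GD_density_stick (y : N.-tuple R) : open_cube y ->
  GD_density a b (stick_fwd y) * tri_jac stick_len [::] y =
  (GD_const N a b)^-1 * tuple_weight square_weight y.
Proof.
move=> y01; rewrite (tri_jac_prod (ell := fun c => 1 - c)); last 3 first.
- exact: stick_len_rcons.
- by rewrite stick_len_nil.
- by move=> x /tnthP[i ->]; rewrite subr_ge0; have /andP[_ /ltW] := y01 i.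
rewrite stick_len_nil expr1n mul1r size_tuple /GD_density -!mulrA; congr (_ * _).
have -> : b N - 1 = 0 by rewrite /b; ring.
rewrite powRr0 mul1r -big_split; apply: eq_bigr => j _ /=.
have /andP[yj0 yj1] := y01 j.
rewrite stick_sum_take tnth_stick_fwd; set L := stick_len _.
have L0 : 0 < L by exact: stick_len_take.
have -> : b j - (a j.+1 + b j.+1) = - (a j.+1 - 1).
  by rewrite /a /b -natr1; field.
rewrite powRM ?(ltW L0)// ?(ltW yj0)// powRN.
rewrite [L `^ _ * _]mulrC -[X in X * _]mulrA divff ?mulr1; last first.
  by rewrite gt_eqF// powR_gt0.
rewrite /square_weight /beta_weight yj0 yj1/= -(tnth_nth 0); congr (_ * _).
by rewrite -natr1 addrK powR_mulrn// subr_ge0 ltW.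
Qed.

End tuples.
End stick_breaking.

Section two_GD_integral.
Context {R : realType} (N : nat).
Local Notation RT n := (n.-tuple (measurableTypeR R)).
Local Notation coin := (bernoulli_prob (2^-1 : R)).

Let a : nat -> R := fun=> 2^-1.
Let b : nat -> R := fun j => N%:R - j%:R + 1.
Let Z := GD_const N a b.

Let Z_ge0 : 0 <= Z.
Proof.
rewrite /Z /GD_const; apply: prodr_ge0 => j _.
by rewrite divr_ge0 ?mulr_ge0 ?Gamma_fun_ge0.
Qed.

Let density_ge0 p : 0 <= @GD_density R N a b p.
Proof.
rewrite /GD_density mulr_ge0// ?mulr_ge0 ?invr_ge0 ?powR_ge0//.
by apply: prodr_ge0 => j _; rewrite mulr_ge0 ?powR_ge0.
Qed.

Let mtnth n i : measurable_fun setT (fun x : RT n => tnth x i : R).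
Proof. exact: (@measurable_tnth _ (measurableTypeR R) n i). Qed.

Let measurable_density : measurable_fun setT (@GD_density R N a b : RT N -> R).
Proof.
have mp (f : RT N -> R) q : measurable_fun setT f -> measurable_fun setT (fun x => f x `^ q).
  by move=> mf; exact: (measurableT_comp (measurable_powR q) mf).
have ms P : measurable_fun setT (fun x : RT N => 1 - \sum_(i < N | P i) tnth x i).
  apply: measurable_funB => //; under eq_fun do rewrite big_mkcond.
  by apply: measurable_sum => i; case: (P i); [exact: mtnth|exact: measurable_cst].
apply: measurable_funM; first apply: measurable_funM => //.
  by apply: mp; exact: ms.
apply: measurable_prod => j _; apply: measurable_funM; apply: mp => //.
Qed.

Let g (p : RT N) : R := if p \in @open_simplex R N then GD_density a b p else 0.

Let g_ge0 p : 0 <= g p. Proof. by rewrite /g; case: ifP. Qed.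

Let mg : measurable_fun setT g.
Proof.
have -> : g = (GD_density a b : RT N -> R) \_ (@open_simplex R N).
  by apply/funext => p; rewrite patchE.
apply/(measurable_restrictT _ _).1; first exact: measurable_open_simplex.
exact: measurable_funTS.
Qed.

Let GDE : @GD R N a b = density_measure (lebesgue_Rn N) g.
Proof.
apply/funext => A; rewrite /GD /density_measure integral_mkcondr.
by apply: eq_integral => p _; rewrite patchE /g; case: ifP.
Qed.

Lemma measurable_canonical_coords_inv :
  measurable_fun setT (@canonical_coords_inv R N : RT N -> RT N).
Proof.
apply/measurable_fun_tnthP => k.
have : measurable_fun setT (fun c : RT N => tnth c k *
    Num.sqrt (\prod_(i < N) (if (i < k)%N then 1 - tnth c i ^+ 2 else 1)) : R).
  have mP : measurable_fun setT (fun c : RT N =>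
      \prod_(i < N) (if (i < k)%N then 1 - tnth c i ^+ 2 else 1) : R).
    apply: measurable_prod => i _; case: (i < k)%N; last exact: measurable_cst.
    apply: measurable_funB; first exact: measurable_cst.
    exact: (measurable_funX 2 (mtnth i)).
  exact: (measurable_funM (mtnth k) (measurableT_comp measurable_sqrt mP)).
by congr measurable_fun; apply/funext => c; rewrite /= tnth_mktuple [in RHS]big_mkcond/=.
Qed.

Local Open Scope ereal_scope.

(** The product measure averages the signs over each section of the preimage of [A]; stick breaking
    then trades the density for a product of Beta weights. *)
Lemma two_GD_integral (A : set (RT N)) : measurable A ->
  two_GD a b A = (Z^-1)%:E *
  \int[lebesgue_Rn N]_y (sign_mean (fun x => (\1_A (canonical_coords_inv x))%:E) y *
                         (tuple_weight square_weight y)%:E).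
Proof.
move=> mA.
have mss : measurable_fun setT
    (fun w : RT N * N.-tuple bool => signed_sqrt w.1 w.2 : RT N).
  exact: measurable_signed_sqrt.
pose B := (fun w : RT N * N.-tuple bool => signed_sqrt w.1 w.2) @^-1` A.
have mB : measurable B by rewrite -[X in measurable X]setTI; exact: mss.
pose h (p : RT N) := power_measure coin N (xsection B p).
have mh : measurable_fun setT h by exact: measurable_fun_xsection.
have h0 p : 0 <= h p by exact: measure_ge0.
pose f (x : RT N) : \bar R := (\1_A (canonical_coords_inv x))%:E.
have f0 x : 0 <= f x by rewrite lee_fin.
have mf : measurable_fun setT f.
  apply/measurable_EFinP.
  apply: (measurableT_comp (measurable_indic mA)).
  exact: measurable_canonical_coords_inv.
have hE y : open_cube y -> h (stick_fwd y) = sign_mean f y.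
  move=> y01; rewrite /h /sign_mean.
  have mxB := measurable_xsection (stick_fwd y : RT N) mB.
  have := integral_indic (power_measure coin N) measurableT mxB.
  rewrite setIT => <-; apply: eq_integral => e _; rewrite /f stick_signed_sqrt//.
  by rewrite /= !indicE mem_xsection.
transitivity (\int[lebesgue_Rn N]_p (h p * (g p)%:E)).
  (* In two_GD the carrier R has its default measurable structure, which has
     the same measurable sets as measurableTypeR R but is not convertible to it. *)
  pose to_default (x : RT N) : N.-tuple R := x.
  pose of_default (x : N.-tuple R) : RT N := x.
  have m1 : measurable_fun setT to_default.
    apply/measurable_fun_tnthP => i.
    exact: (@measurable_tnth _ (measurableTypeR R) N i).
  have m2 : measurable_fun setT of_default.
    apply/measurable_fun_tnthP => i.
    exact: (@measurable_tnth _ R N i).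
  pose nu := measure_function_pushforward__canonical__measure_function_Measure
    (density (lebesgue_Rn N) mg g_ge0) m1.
  rewrite -ge0_integral_density//.
  transitivity (\int[nu]_x (h \o of_default) x).
    by rewrite /two_GD {1}/pushforward /product_measure1 GDE.
  by rewrite (ge0_integral_pushforward m1)//; exact: (measurableT_comp mh m2).
pose F (y : RT N) : \bar R := if y \in @open_cube R N then
  h (stick_fwd y) * (GD_density a b (stick_fwd y))%:E else 0.
have F0 y : 0 <= F y by rewrite /F; case: ifP => // _; rewrite mule_ge0// lee_fin.
have mF : measurable_fun setT F.
  have -> : F = (fun y : RT N => h (stick_fwd y) * (GD_density a b (stick_fwd y))%:E)
      \_ (@open_cube R N).
    by apply/funext => y; rewrite patchE.
  apply/(measurable_restrictT _ _).1; first exact: measurable_open_cube.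
  apply: measurable_funTS; apply: emeasurable_funM.
    by apply: measurableT_comp => //; exact: measurable_stick_fwd.
  apply/measurable_EFinP.
  by apply: (measurableT_comp measurable_density); exact: measurable_stick_fwd.
transitivity (\int[lebesgue_Rn N]_p F (stick_inv p)).
  apply: eq_integral => p _; rewrite /F /g.
  have [pS|pS] := boolP (p \in @open_simplex R N).
    have p01 : open_cube (stick_inv p) by apply/open_simplex_stick; exact/set_mem.
    by rewrite mem_set// stick_invK.
  rewrite memNset ?mule0// => p01; move/negP: pS; apply.
  by apply/mem_set/open_simplex_stick.
rewrite (ge0_integral_tri measurable_stick_lo measurable_stick_len stick_len_neq0)//; last first.
  by rewrite stick_len_nil oner_neq0.
rewrite -ge0_integralZl//; last 3 first.
- apply: emeasurable_funM; first exact: measurable_sign_mean.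
  by apply: measurable_tupleE; exact: measurable_square_weight.
- move=> y _; rewrite mule_ge0 ?sign_mean_ge0// lee_fin tuple_weight_ge0//.
  exact: square_weight_ge0.
- by rewrite lee_fin invr_ge0.
apply: eq_integral => y _; rewrite /F; have [yC|yC] := boolP (y \in _).
  have y01 : open_cube y by exact/set_mem.
  by rewrite hE// -muleA -EFinM GD_density_stick// EFinM muleCA.
have -> : tuple_weight square_weight y = 0%R; last by rewrite !(mul0e, mule0).
have [i yi] : exists i, ~~ (0 < tnth y i < 1)%R.
  apply/existsP; rewrite -negb_forall; apply: contraNN yC => /forallP y01.
  exact/mem_set.
apply/eqP; rewrite /tuple_weight prodf_seq_eq0; apply/hasP; exists i => //=.
  by rewrite mem_index_enum.
by rewrite /square_weight /beta_weight (negbTE yi).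
Qed.

(** The Gamma quotients in [GD_const] are one-dimensional Beta integrals, [b i.+1] being the
    positive integer [(N - i.+1).+1]. *)
Lemma integral_square_weight :
  \int[lebesgue_Rn N]_y (tuple_weight square_weight y)%:E = Z%:E /\ (0 < Z)%R.
Proof.
pose I k : R := (Gamma_fun 2^-1 * Gamma_fun k.+1%:R / Gamma_fun (2^-1 + k.+1%:R))%R.
have wI k : \int[@lebesgue_measure R]_y (square_weight k y)%:E = (I k)%:E.
  by have [] := @beta_half R k.
have I0 k : (0 < I k)%R.
  by have [IE /andP[]] := @beta_half R k; rewrite IE lte_fin.
have -> : Z = (\prod_(i < N) I (N - i.+1)%N)%R.
  rewrite /Z /GD_const big_add1 big_mkord; apply: eq_bigr => i _.
  have -> : (b i.+1 = (N - i.+1)%N.+1%:R)%R by rewrite /b -[RHS]natr1 natrB.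
  by [].
split; last by apply: prodr_gt0.
suff H n : \int[lebesgue_Rn n]_y (tuple_weight square_weight y)%:E =
    (\prod_(i < n) I (n - i.+1)%N)%:E by exact: H.
elim: n => [|n IHn].
  rewrite ge0_integral_power0 ?big_ord0; first by rewrite /tuple_weight big_ord0.
  by move=> x; rewrite lee_fin tuple_weight_ge0//; exact: square_weight_ge0.
rewrite /lebesgue_Rn ge0_integral_powerS; last 2 first.
- by apply: measurable_tupleE; exact: measurable_square_weight.
- by move=> x; rewrite lee_fin tuple_weight_ge0//; exact: square_weight_ge0.
under eq_integral do under eq_integral do rewrite tuple_weight_cons EFinM.
under eq_integral => x _.
  rewrite ge0_integralZl//; last 3 first.
  - by apply: measurable_tupleE; exact: measurable_square_weight.
  - by move=> y _; rewrite lee_fin tuple_weight_ge0//; exact: square_weight_ge0.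
  - by rewrite lee_fin square_weight_ge0.
  rewrite [X in _ * X]IHn.
  over.
rewrite ge0_integralZr//; last 3 first.
- by apply/measurable_EFinP; exact: measurable_square_weight.
- by move=> y _; rewrite lee_fin; exact: square_weight_ge0.
- by rewrite lee_fin prodr_ge0// => i _; exact: ltW.
rewrite wI -EFinM big_ord_recl subn1/=; congr (_ * _)%:E.
Qed.

End two_GD_integral.

(** * The uniform measure on the moment space *)

Section uniform_moment_space.
Context {R : realType} (N : nat).
Local Notation RT n := (n.-tuple (measurableTypeR R)).
Local Open Scope ereal_scope.

Let lenn0 : moment_len ([::] : seq R) != 0%R.
Proof. by rewrite /moment_len big_nil oner_neq0. Qed.

Lemma tri_jac_moment (c : RT N) : open_cube c ->
  tri_jac moment_len [::] c = tuple_weight canon_weight c.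
Proof.
move=> c01; rewrite (tri_jac_prod (ell := fun a => (a * (1 - a))%R)); last 3 first.
- exact: moment_len_rcons.
- by rewrite /moment_len big_nil.
- move=> x /tnthP[i ->]; have /andP[c0 c1] := c01 i.
  by rewrite mulr_ge0 ?subr_ge0 ?ltW.
rewrite /moment_len big_nil expr1n mul1r size_tuple; apply: eq_bigr => i _.
by rewrite /canon_weight (c01 i) -(tnth_nth 0%R).
Qed.

(** [S] is not assumed measurable. It lies between [U] and its union with the null set [F], and
    [le_power_measure] compares arbitrary sets. *)
Lemma lebesgue_Rn_moment_sandwich (S B : set (RT N)) : measurable B ->
  (forall m, open_cube (moment_inv m) -> B (moment_inv m) -> S m) ->
  (forall m, S m -> open_cube (moment_inv m) /\ B (moment_inv m) \/
                    cube_faces (moment_inv m)) ->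
  lebesgue_Rn N S =
  \int[lebesgue_Rn N]_c ((\1_B c)%:E * (tuple_weight canon_weight c)%:E).
Proof.
move=> mB inS Sin.
pose C : set (RT N) := @open_cube R N `&` B.
have mC : measurable C by apply: measurableI => //; exact: measurable_open_cube.
have mlo := @measurable_moment_lo R; have mlen := @measurable_moment_len R.
have minv := @measurable_tri_inv_tuple R _ _ mlo mlen N [::].
pose U : set (RT N) := [set m | C (moment_inv m)].
pose F : set (RT N) := [set m | @cube_faces R N (moment_inv m)].
have mU : measurable U by rewrite -[X in measurable X]setTI; exact: minv.
have mF : measurable F.
  rewrite -[X in measurable X]setTI; apply: minv => //; exact: measurable_cube_faces.
have F0 : lebesgue_Rn N F = 0.
  exact: (lebesgue_Rn_tri_inv_cube_faces mlo mlen (@moment_len_rcons_neq0 R) N lenn0).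
have -> : lebesgue_Rn N S = lebesgue_Rn N U.
  apply/eqP; rewrite eq_le; apply/andP; split.
    rewrite -(measureU0 mU mF F0); apply: le_power_measure => m /Sin[[? ?]|?].
      by left; split.
    by right.
  by apply: le_power_measure => m [? ?]; exact: inS.
have -> : lebesgue_Rn N U = \int[lebesgue_Rn N]_(c in C) (tri_jac moment_len [::] c)%:E.
  exact: (lebesgue_Rn_tri_inv mlo mlen (@moment_len_rcons_neq0 R) lenn0 mC).
rewrite integral_mkcond; apply: eq_integral => c _; rewrite patchE.
have [cC|cC] := boolP (c \in C).
  have [c01 cB] := set_mem cC.
  by rewrite indicE mem_set// mul1e tri_jac_moment.
have [c01|c01] := pselect (open_cube c).
  by rewrite indicE memNset ?mul0e// => cB; move/negP: cC; apply; exact/mem_set.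
have -> : tuple_weight canon_weight c = 0%R; last by rewrite mule0.
have [i ci] : exists i, ~~ (0 < tnth c i < 1)%R.
  by apply/existsP; rewrite -negb_forall; apply/negP => /forallP.
apply/eqP; rewrite /tuple_weight prodf_seq_eq0; apply/hasP; exists i => //=.
  by rewrite mem_index_enum.
by rewrite /canon_weight (negbTE ci).
Qed.

Let mean (A : set (RT N)) := \int[lebesgue_Rn N]_y
  (sign_mean (fun x => (\1_A (canonical_coords_inv x))%:E) y *
   (tuple_weight square_weight y)%:E).

Let K : R := \prod_(i < N) square_ratio i.

(** Serves twice, for the event itself and with [A = setT] for the total volume, so that [K] cancels
    in the quotient. *)
Lemma lebesgue_Rn_Sigma (A S : set (RT N)) : measurable A ->
  (forall m, open_cube (moment_inv m) -> A (Sigma_map m) -> S m) ->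
  (forall m, S m -> open_cube (moment_inv m) /\ A (Sigma_map m) \/
                    cube_faces (moment_inv m)) ->
  lebesgue_Rn N S = K%:E * mean A.
Proof.
move=> mA inS Sin.
pose B : set (RT N) := [set c | A (canonical_coords_inv (double_sub1 c))].
have SigmaE m : open_cube (moment_inv m) ->
    Sigma_map m = canonical_coords_inv (double_sub1 (moment_inv m)).
  by move=> m01; rewrite /Sigma_map canonical_moments_inv.
have mB : measurable B.
  have := measurableT_comp (@measurable_canonical_coords_inv R N)
    (@measurable_double_sub1 R N).
  by move=> /(_ measurableT A mA); rewrite setTI.
rewrite (lebesgue_Rn_moment_sandwich mB); last 2 first.
- by move=> m m01 mBm; apply: inS => //; rewrite SigmaE.
- move=> m /Sin[[m01]|]; last by right.
  by rewrite SigmaE//; left.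
rewrite /mean -integral_canon_square_tuple.
- by apply: eq_integral => c _; rewrite !indicE.
- apply/measurable_EFinP.
  by apply: (measurableT_comp (measurable_indic mA)); exact: measurable_canonical_coords_inv.
- by move=> x; rewrite lee_fin.
Qed.

Lemma meanT : mean setT = \int[lebesgue_Rn N]_y (tuple_weight square_weight y)%:E.
Proof.
apply: eq_integral => y _; rewrite /sign_mean.
rewrite (eq_integral (cst 1)); last by move=> e _; rewrite indicT.
rewrite integral_cst// mul1e.
have := @power_measure_box _ _ R (bernoulli_prob (2^-1 : R)) N (fun=> setT) (fun=> measurableT).
rewrite big1 => [|i _]; last exact: probability_setT.
rewrite (_ : [set x | _] = setT); last by apply/seteqP; split.
by move=> coin1; rewrite [X in X * _]coin1 mul1e.
Qed.

End uniform_moment_space.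

Theorem mainTheorem11 (R : realType) (N : nat) (hN : (1 <= N)%N)
    (A : set (N.-tuple (measurableTypeR R))) (mA : measurable A) :
  pushforward_on (@uniform_moment_space R N)
    (interior_Rn (@moment_space R N)) (@Sigma_map R N) A =
  two_GD (fun=> 2^-1) (fun j => N%:R - j%:R + 1) A.
Proof.
rewrite two_GD_integral//.
have [ZE Z0] := @integral_square_weight R N.
rewrite /pushforward_on /uniform_moment_space.
have K0 : 0 < \prod_(i < N) square_ratio i :> R.
  by apply: prodr_gt0 => i _; rewrite /square_ratio divr_gt0// invr_gt0 exprn_gt0.
rewrite (lebesgue_Rn_Sigma mA); last 2 first.
- move=> m m01 mAm; split; last exact: open_cube_moment_space.
  by split=> //; exact: open_cube_interior.
- move=> m [[_ mAm] /moment_space_sub[m01|]]; last by right.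
  by left.
rewrite (@lebesgue_Rn_Sigma R N setT); last 3 first.
- exact: measurableT.
- by move=> m m01 _; exact: open_cube_moment_space.
- by move=> m /moment_space_sub[m01|]; [left|right].
(* What remains is [K] times the mean of [A], divided by [K] times the normalising constant of the
   Dirichlet density. *)
rewrite meanT ZE -EFinM /= muleAC -EFinM; congr (_%:E * _)%E.
by rewrite invfM mulrA divff ?mul1r// gt_eqF.
Qed.
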